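(* Let $T>0$ and let $(c^k,v^k)\in\vec{\mathrm{CE}}_T(c^k(0),c^k(T))$, $k\in\mathbb N$, satisfy $\sup_k\int_0^T\vec{\mathcal A}(c^k(t),v^k(t))dt\le C<\infty$. Then there exist a subsequence and a limit $(c,v)$ such that $c^k\to c$ uniformly on $[0,T]$ along the subsequence, $(c,v)\in\vec{\mathrm{CE}}_T(c(0),c(T))$, and $$\liminf_{k\to\infty}\int_0^T\vec{\mathcal A}(c^k(t),v^k(t))dt\ge\int_0^T\vec{\mathcal A}(c(t),v(t))dt.$$
   Context: $\mathcal X=\{1,\dots,d\}$ finite, $\mathcal P(\mathcal X)\subset\mathbb R^{\mathcal X}$. $\{Q(\mu)\}$ rate matrices ($Q_{xy}\ge0$, $x\ne y$), each irreducible and reversible w.r.t. a Gibbs measure $\pi(\mu)$, with $\mu\mapsto Q_{xy}(\mu)$ Lipschitz on $\mathcal P(\mathcal X)$. $\Lambda(s,t)=\int_0^1s^\alpha t^{1-\alpha}d\alpha$, $w_{xy}(\mu)=\Lambda(\mu_xQ_{xy}(\mu),\mu_yQ_{yx}(\mu))$. $(\delta v)_x=\frac12\sum_y(v_{xy}-v_{yx})$. $(c,v)\in\vec{\mathrm{CE}}_T(\mu,\nu)$: $c:[0,T]\to\mathcal P(\mathcal X)$ continuous, $c(0)=\mu$, $c(T)=\nu$, $v:[0,T]\to\mathbb R^{\mathcal X\times\mathcal X}$ measurable and integrable, $\int_0^T[\dot\varphi c_x-\varphi(\delta v)_x]dt=0$ for all $\varphi\in C^1_c((0,T))$, $x\in\mathcal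 X$. $\alpha(v,w)=v^2/w$ if $w>0$, $0$ if $v=w=0$, $+\infty$ otherwise; $\vec{\mathcal A}(\mu,v)=\frac12\sum_{x,y}\alpha(v_{xy},w_{xy}(\mu))$. *)

(* Defs.v *)
From HB Require Import structures.
From mathcomp Require Import all_boot all_order all_algebra.
From mathcomp Require Import all_classical all_reals all_analysis.
Set Implicit Arguments. Unset Strict Implicit. Unset Printing Implicit Defensive.
Import Order.TTheory GRing.Theory Num.Theory.
Import numFieldNormedType.Exports.
Local Open Scope classical_set_scope.
Local Open Scope ring_scope.

(* The state space X = {1,...,d} is modelled as 'I_d. *)

Definition is_prob {R : realType} (d : nat) (mu : 'I_d -> R) : Prop :=
  (forall x, 0 <= mu x) /\ \sum_(x < d) mu x = 1.

Definition rate_family {R : realType} (d : nat)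
  (Q : ('I_d -> R) -> 'I_d -> 'I_d -> R) : Prop :=
  (forall mu, is_prob mu -> forall x y, x != y -> 0 <= Q mu x y) /\
  (forall mu, is_prob mu -> forall x y,
      connect (fun a b : 'I_d => (a != b) && (0 < Q mu a b)) x y) /\
  (exists pi : ('I_d -> R) -> 'I_d -> R,
      forall mu, is_prob mu ->
        is_prob (pi mu) /\ (forall x, 0 < pi mu x) /\
        (forall x y, pi mu x * Q mu x y = pi mu y * Q mu y x)) /\
  (exists L : R, forall mu nu, is_prob mu -> is_prob nu -> forall x y,
      `|Q mu x y - Q nu x y| <= L * \sum_(z < d) `|mu z - nu z|).

Definition logmean {R : realType} (s t : R) : R :=
  Rintegral lebesgue_measure `[0%R, 1%R] (fun a : R => s `^ a * t `^ (1 - a)).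

Definition wgt {R : realType} (d : nat) (Q : ('I_d -> R) -> 'I_d -> 'I_d -> R)
  (mu : 'I_d -> R) (x y : 'I_d) : R :=
  logmean (mu x * Q mu x y) (mu y * Q mu y x).

Definition ediv {R : realType} (d : nat) (v : 'I_d -> 'I_d -> R) (x : 'I_d) : R :=
  2^-1 * \sum_(y < d) (v x y - v y x).

Definition alpha {R : realType} (v w : R) : \bar R :=
  if 0 < w then ((v ^+ 2) / w)%:E
  else if (v == 0) && (w == 0) then 0%E else +oo%E.

Definition action {R : realType} (d : nat) (Q : ('I_d -> R) -> 'I_d -> 'I_d -> R)
  (mu : 'I_d -> R) (v : 'I_d -> 'I_d -> R) : \bar R :=
  ((2^-1)%:E * \sum_(x < d) \sum_(y < d) alpha (v x y) (wgt Q mu x y))%E.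

(* phi in C^1_c((0,T)) (extended by 0 outside (0,T)) *)
Definition C1c {R : realType} (T : R) (phi : R -> R) : Prop :=
  (forall t, derivable phi t 1) /\ continuous (derive1 phi) /\
  exists a b : R, 0 < a /\ a <= b /\ b < T /\
    (forall t, t < a \/ b < t -> phi t = 0).

Definition CE {R : realType} (d : nat) (T : R) (mu nu : 'I_d -> R)
  (c : R -> 'I_d -> R) (v : R -> 'I_d -> 'I_d -> R) : Prop :=
  (forall t, t \in `[0, T] -> is_prob (c t)) /\
  (forall x, {within `[0, T], continuous (fun t => c t x)}) /\
  c 0 = mu /\ c T = nu /\
  (forall x y, lebesgue_measure.-integrable `[0, T] (fun t => (v t x y)%:E)) /\
  (forall phi, C1c T phi -> forall x,
     Rintegral lebesgue_measure `[0, T]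
       (fun t => derive1 phi t * c t x - phi t * ediv (v t) x) = 0).

Definition total_action {R : realType} (d : nat)
  (Q : ('I_d -> R) -> 'I_d -> 'I_d -> R) (T : R)
  (c : R -> 'I_d -> R) (v : R -> 'I_d -> 'I_d -> R) : \bar R :=
  (\int[lebesgue_measure]_(t in `[0%R, T]%classic) action Q (c t) (v t))%E.

(* Main.v *)
(* The energy bound makes the fluxes bounded in L^2 in time, so the curves are
   equicontinuous and a subsequence converges uniformly, together with the
   actions.  No weak compactness is used for the fluxes: the sets K_n of fluxes
   which, like v^k for k >= n and all their convex combinations, almost satisfy
   the limit continuity equation and almost have the limit action, are
   decreasing and convex, and elements of K_n of almost minimal L^2 norm form a
   Cauchy sequence by the parallelogram identity.  Their almost everywhere limit
   solves the continuity equation, and Fatou's lemma with the joint convexity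
   and lower semicontinuity of v^2 / w gives the action bound. *)

Require Import Defs.
From HB Require Import structures.
From mathcomp Require Import all_boot all_order all_algebra.
From mathcomp Require Import all_classical all_reals all_analysis.
From mathcomp Require Import measurable_realfun.
From mathcomp Require Import ring lra.
Import Order.TTheory GRing.Theory Num.Theory.
Import numFieldNormedType.Exports.
Local Open Scope classical_set_scope.
Local Open Scope ring_scope.

(** The obstacle is that each [v^k] belongs to its own curve. A convex combination of fluxes solves
    no exact continuity equation for the limit curve, and joint convexity of the action pairs it
    with a combination of weights that need not be the weight of any measure. So membership in [K_n]
    is stated relative to the limit curve, with two tolerances: an error of the equation
    proportional to the L1 norm of [phi'], which is what replacing [c^k] by the limit costs after
    the derivative has been put on the test function, and an existentially quantified weight at
    least as close to the limit weight as the weights of index [>= n]. Midpoints are the only convex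
    combinations required, since the parallelogram identity uses nothing else. Almost minimizers are
    taken with errors [4^-j] so that no further subsequence has to be extracted for almost
    everywhere convergence. The action is compared through monotonicity of the integral as a
    supremum over simple functions, because its diagonal terms may fail to be measurable in time. *)

Lemma lebesgue_itv_lty {R : realType} (a b : R) :
  (@lebesgue_measure R `[a, b] < +oo)%E.
Proof. by rewrite lebesgue_measure_itv/=; case: ifPn => _; rewrite ?ltry// -EFinB ltry. Qed.

Lemma harmonic_bound_cvg {R : realType} (u : nat -> R) (l : R) :
  (forall n, `|u n - l| <= n.+1%:R^-1) -> u @ \oo --> l.
Proof.
move=> ul; apply/cvgrPdist_lt => e e0.
have [N _ hN] := (cvgrPdist_lt _ _).1 (@cvg_harmonic R) _ e0.
exists N => // n /hN; rewrite /= sub0r normrN ger0_norm// distrC.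
exact: le_lt_trans.
Qed.

Lemma bounded_integrable_itv {R : realType} (a b M : R) (f : R -> R) :
  measurable_fun `[a, b] f -> (forall t, t \in `[a, b] -> `|f t| <= M) ->
  (@lebesgue_measure R).-integrable `[a, b] (EFin \o f).
Proof.
move=> mf fM; apply: measurable_bounded_integrable => //; first exact: lebesgue_itv_lty.
exists M; split; first exact: num_real.
by move=> N MN t tab /=; rewrite (le_trans (fM t tab))// ltW.
Qed.

(** * The logarithmic mean on the closed quadrant: bounds and continuity *)

Section LogMean.
Context {R : realType}.
Implicit Types (s t M : R).
Local Notation mu := (@lebesgue_measure R).

Let seq_bounded (u : nat -> R) (l : R) : u @ \oo --> l -> exists M, forall n, `|u n| <= M.
Proof.
move=> ul; have [M [_ h]] := @cvg_seq_bounded _ R u (cvgP _ ul).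
by exists (M + 1) => n; apply: (h (M + 1)) => //; rewrite ltrDl.
Qed.

Lemma powR_seq_cvg (s_ : nat -> R) (s a : R) : (forall n, 0 <= s_ n) -> 0 <= a ->
  s_ @ \oo --> s -> (fun n => s_ n `^ a) @ \oo --> s `^ a.
Proof.
move=> s_0; rewrite le_eqVlt => /predU1P[<-|a0] s_s.
  by under eq_fun do rewrite powRr0; rewrite powRr0; exact: cvg_cst.
have s0 : 0 <= s.
  by rewrite -(cvg_lim _ s_s)//; apply: limr_ge; [exact/cvgP/s_s|exact: nearW].
move: s0; rewrite le_eqVlt => /predU1P[s0|s0].
  rewrite -s0 powR0 ?gt_eqF//; apply/cvgr0Pnorm_lt => e e0.
  have d0 : 0 < e `^ a^-1 by exact: powR_gt0.
  move: s_s; rewrite -s0 => /cvgr0Pnorm_lt/(_ _ d0).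
  apply: filterS => n; rewrite !ger0_norm ?powR_ge0// => h.
  rewrite -(powRr1 (ltW e0)) -(mulVf (lt0r_neq0 a0)) powRrM.
  by rewrite gt0_ltr_powR// nnegrE ?powR_ge0.
have : derivable (fun x => x `^ a) s 1 by apply: derivable_powR; rewrite in_itv/= s0.
move/derivable1_diffP/differentiable_continuous => ca.
exact: (cvg_comp _ _ s_s ca).
Qed.

Local Notation I01 := (`[0%R, 1%R]%classic : set R).

Let powR_mul_bound s t M a : 0 <= s <= M -> 0 <= t <= M -> I01 a ->
  0 <= s `^ a * t `^ (1 - a) <= M.
Proof.
move=> /andP[s0 sM] /andP[t0 tM]; rewrite /= in_itv/= => /andP[a0 a1].
rewrite mulr_ge0 ?powR_ge0//=.
have M0 : 0 <= M by exact: le_trans sM.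
apply: (@le_trans _ _ (M `^ a * M `^ (1 - a))).
  by apply: ler_pM; rewrite ?powR_ge0//; apply: ge0_ler_powR;
    rewrite ?nnegrE// subr_ge0.
by rewrite -powRD ?subrKC ?powRr1// oner_eq0.
Qed.

Let measurable_logmean s t :
  measurable_fun I01 (fun a : R => s `^ a * t `^ (1 - a)).
Proof.
apply: measurable_funTS; apply: measurable_funM => //.
  exact: measurable_powRr.
apply: (@measurableT_comp _ _ _ _ _ _ (powR t)); first exact: measurable_powRr.
exact: measurable_funB.
Qed.

Let integrable_cst M : mu.-integrable I01 (cst M%:E).
Proof. by apply: (@bounded_integrable_itv _ _ _ `|M| (cst M)). Qed.

Let integrable_logmean s t : 0 <= s -> 0 <= t ->
  mu.-integrable I01 (EFin \o (fun a : R => s `^ a * t `^ (1 - a))).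
Proof.
move=> s0 t0; apply: (@bounded_integrable_itv _ _ _ (Num.max s t)).
  exact: measurable_logmean.
move=> a aI; have /andP[h0 h1] : 0 <= s `^ a * t `^ (1 - a) <= Num.max s t.
  by apply: powR_mul_bound => //; rewrite ?s0 ?t0/= le_max lexx ?orbT.
by rewrite ger0_norm.
Qed.

Lemma logmean_ge0 s t : 0 <= logmean s t.
Proof. by apply: Rintegral_ge0 => a _; rewrite mulr_ge0 ?powR_ge0. Qed.

Lemma logmean_le s t M : 0 <= s <= M -> 0 <= t <= M -> logmean s t <= M.
Proof.
move=> sM tM; have [s0 _] := andP sM; have [t0 _] := andP tM.
have -> : M = Rintegral mu I01 (cst M).
  rewrite Rintegral_cst//= lebesgue_measure_itv/= lte_fin ltr01 sube0.
  by rewrite /= mulr1.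
apply: le_Rintegral => //; first exact: integrable_logmean.
  exact: integrable_cst.
by move=> a aI; have /andP[] := powR_mul_bound _ _ _ _ sM tM aI.
Qed.

(** Dominated convergence: a weighted geometric mean never exceeds a common bound of its two
    arguments, so one constant dominates all integrands, also when a limit is 0. *)
Lemma logmean_seq_cvg (s_ t_ : nat -> R) s t :
  (forall n, 0 <= s_ n) -> (forall n, 0 <= t_ n) ->
  s_ @ \oo --> s -> t_ @ \oo --> t ->
  (fun n => logmean (s_ n) (t_ n)) @ \oo --> logmean s t.
Proof.
move=> s_0 t_0 s_s t_t.
have s0 : 0 <= s.
  by rewrite -(cvg_lim _ s_s)//; apply: limr_ge; [exact/cvgP/s_s|exact: nearW].
have t0 : 0 <= t.
  by rewrite -(cvg_lim _ t_t)//; apply: limr_ge; [exact/cvgP/t_t|exact: nearW].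
have [Ms sM] := seq_bounded _ _ s_s; have [Mt tM] := seq_bounded _ _ t_t.
pose M := Num.max Ms Mt.
have bnd n a : I01 a -> 0 <= s_ n `^ a * t_ n `^ (1 - a) <= M.
  apply: powR_mul_bound; rewrite ?s_0 ?t_0/= /M le_max.
    by rewrite -[s_ n]ger0_norm ?sM.
  by rewrite -[t_ n]ger0_norm ?tM ?orbT.
have [| | | | | |_ _ h] := @dominated_convergence _ _ R mu I01 _
    (fun n a => (s_ n `^ a * t_ n `^ (1 - a))%:E)
    (fun a => (s `^ a * t `^ (1 - a))%:E) (cst M%:E).
- by [].
- by move=> n; apply/measurable_EFinP; exact: measurable_logmean.
- by apply/measurable_EFinP; exact: measurable_logmean.
- apply: aeW => a aI; apply: cvg_EFin; first exact: nearW.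
  have /andP[a0 a1] : 0 <= a <= 1 by move: aI; rewrite /= in_itv.
  by apply: cvgM; apply: powR_seq_cvg => //; rewrite subr_ge0.
- exact: integrable_cst.
- apply: aeW => a n aI /=; rewrite lee_fin.
  by have /andP[h0 h1] := bnd n a aI; rewrite ger0_norm.
- apply: fine_cvg; rewrite fineK; first exact: h.
  by apply: integrable_fin_num => //; exact: integrable_logmean.
Qed.

(** By contradiction from sequential continuity: a bad pair at each distance [1/(n+1)] would form a
    convergent sequence. Perturbations stay in the closed quadrant, where the off-diagonal fluxes
    live. *)
Lemma logmean_continuous s t e : 0 <= s -> 0 <= t -> 0 < e ->
  exists2 d, 0 < d & forall s' t', 0 <= s' -> 0 <= t' ->
    `|s' - s| < d -> `|t' - t| < d -> `|logmean s' t' - logmean s t| < e.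
Proof.
move=> s0 t0 e0; apply: contrapT => H.
have {H} H n : exists st : R * R, [/\ 0 <= st.1, 0 <= st.2,
    `|st.1 - s| < n.+1%:R^-1, `|st.2 - t| < n.+1%:R^-1 &
    e <= `|logmean st.1 st.2 - logmean s t| ].
  apply: contrapT => Hn; apply: H; exists n.+1%:R^-1; first by rewrite invr_gt0.
  move=> s' t' s'0 t'0 hs ht; rewrite ltNge; apply/negP => h.
  by apply: Hn; exists (s', t').
have {H}[f Hf] := choice H.
have /cvgrPdist_lt/(_ _ e0) : (fun n => logmean (f n).1 (f n).2) @ \oo --> logmean s t.
  by apply: logmean_seq_cvg => [n|n| |]; (try apply: harmonic_bound_cvg => n);
    have [? ? h1 h2 ?] := Hf n => //; exact: ltW.
move=> [N _ /(_ N (leqnn _))] /=; have [_ _ _ _] := Hf N.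
by rewrite distrC => h1 h2; have := le_lt_trans h1 h2; rewrite ltxx.
Qed.

End LogMean.

(** * Lower limits of nonnegative extended real sequences *)

Section LimInf.
Context {R : realType}.
Local Open Scope ereal_scope.
Implicit Types u v : nat -> \bar R.

Lemma le_limn_einf u v : (forall n, u n <= v n) -> limn_einf u <= limn_einf v.
Proof.
move=> uv; rewrite !limn_einf_lim; apply: lee_lim; [exact: is_cvg_einfs..|].
apply: nearW => n; apply: le_ereal_inf_tmp => _ [m /= nm <-].
by apply: le_trans (uv m); apply: ereal_inf_lbound; exists m.
Qed.

Lemma limn_einf_ge0 u : (forall n, 0 <= u n) -> 0 <= limn_einf u.
Proof.
move=> u0; have -> : 0 = limn_einf (fun=> 0 : \bar R).
  by rewrite (cvg_limn_einf_sup (cvg_cst _)).1.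
exact: le_limn_einf.
Qed.

Lemma limn_einfD_ge u v : (forall n, 0 <= u n) -> (forall n, 0 <= v n) ->
  limn_einf u + limn_einf v <= limn_einf (fun n => u n + v n).
Proof.
have einfs0 w : (forall n, 0 <= w n) -> forall n, 0 <= einfs w n.
  by move=> w0 n; apply: le_ereal_inf_tmp => _ [m /= nm <-].
move=> u0 v0; rewrite !limn_einf_lim -limeD; [|exact: is_cvg_einfs..|]; last first.
  by apply: ge0_adde_def; rewrite inE; apply: lime_ge;
    [exact: is_cvg_einfs|exact/nearW/einfs0|exact: is_cvg_einfs|exact/nearW/einfs0].
apply: lee_lim; [|exact: is_cvg_einfs|].
  apply: is_cvgeD; [|exact: is_cvg_einfs..].
  by apply: ge0_adde_def; rewrite inE; apply: lime_ge;
    [exact: is_cvg_einfs|exact/nearW/einfs0|exact: is_cvg_einfs|exact/nearW/einfs0].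
apply: nearW => n; apply: le_ereal_inf_tmp => _ [m /= nm <-].
by apply: leeD; apply: ereal_inf_lbound; exists m.
Qed.

Lemma limn_einf_sum_ge (I : Type) (r : seq I) (u : I -> nat -> \bar R) :
  (forall i n, 0 <= u i n) ->
  \sum_(i <- r) limn_einf (u i) <= limn_einf (fun n => \sum_(i <- r) u i n).
Proof.
move=> u0; elim: r => [|i r IH].
  by rewrite big_nil; apply: limn_einf_ge0 => n; rewrite big_nil.
rewrite big_cons; under [X in _ <= limn_einf X]eq_fun do rewrite big_cons.
apply: le_trans (limn_einfD_ge _ _ _ _) => //; first exact: leeD.
by move=> n; apply: sume_ge0.
Qed.

End LimInf.

(** * The integrand [v^2 / w]: convexity, lower semicontinuity, measurability *)

Section Alpha.
Context {R : realType}.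
Implicit Types (v w M q : R) (b : \bar R).

Lemma alpha_ge0 v w : (0 <= alpha v w)%E.
Proof.
rewrite /alpha; case: ifPn => [w0|_]; last by case: ifPn.
by rewrite lee_fin divr_ge0 ?sqr_ge0 ?ltW.
Qed.

(* [alpha v] is the Legendre-type supremum over [q] of the affine functions
   [2 q v - q^2 w]; convexity and lower semicontinuity both follow. *)
Lemma alpha_ge_affine v w q : 0 <= w -> ((2 * q * v - q ^+ 2 * w)%:E <= alpha v w)%E.
Proof.
rewrite le_eqVlt /alpha => /predU1P[<-|w0].
  by rewrite ltxx eqxx andbT; case: eqP => [->|_]; rewrite ?leey// !mulr0 subrr.
rewrite w0 lee_fin ler_pdivlMr// -subr_ge0.
have -> : v ^+ 2 - (2 * q * v - q ^+ 2 * w) * w = (v - q * w) ^+ 2 by ring.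
exact: sqr_ge0.
Qed.

(** For [w > 0] the supremum is attained at [q = v / w]. For [w = 0] and [v <> 0], the choice
    [q = r / (2 v)] gives the affine function any real value [r], so [b] must be [+oo]. *)
Lemma alpha_le_sup v w b : 0 <= w ->
  (forall q, ((2 * q * v - q ^+ 2 * w)%:E <= b)%E) -> (alpha v w <= b)%E.
Proof.
rewrite le_eqVlt /alpha => /predU1P[<-|w0] h; last first.
  rewrite w0; have := h (v / w); apply: le_trans; rewrite lee_fin le_eqVlt.
  by apply/orP; left; apply/eqP; field; rewrite gt_eqF.
rewrite ltxx eqxx andbT; case: eqP => [v0|/eqP v0].
  by have := h 0; rewrite v0 !mulr0 subrr.
have hr (r : R) : (r%:E <= b)%E.
  have := h (r / (2 * v)); rewrite mulr0 subr0; congr (_%:E <= _)%E.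
  by field; rewrite v0.
case: b hr {h} => [r hr|//|/(_ 0)]; last by rewrite leeNy_eq.
by have := hr (r + 1); rewrite lee_fin leNgt ltrDl ltr01.
Qed.

Lemma alpha_midpoint v1 v2 w1 w2 : 0 <= w1 -> 0 <= w2 ->
  (alpha (2^-1 * (v1 + v2)) (2^-1 * (w1 + w2)) <=
   (2^-1)%:E * (alpha v1 w1 + alpha v2 w2))%E.
Proof.
move=> w10 w20; apply: alpha_le_sup => [|q]; first by rewrite mulr_ge0 ?addr_ge0.
have -> : 2 * q * (2^-1 * (v1 + v2)) - q ^+ 2 * (2^-1 * (w1 + w2)) =
  2^-1 * ((2 * q * v1 - q ^+ 2 * w1) + (2 * q * v2 - q ^+ 2 * w2)) by ring.
by rewrite EFinM EFinD lee_wpmul2l ?lee_fin// leeD// alpha_ge_affine.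
Qed.

Lemma alpha_lsc (v_ w_ : nat -> R) v w : (forall n, 0 <= w_ n) -> 0 <= w ->
  v_ @ \oo --> v -> w_ @ \oo --> w ->
  (alpha v w <= limn_einf (fun n => alpha (v_ n) (w_ n)))%E.
Proof.
move=> w_0 w0 v_v w_w; apply: alpha_le_sup => // q.
have h : (fun n => (2 * q * v_ n - q ^+ 2 * w_ n)%:E) @ \oo -->
    (2 * q * v - q ^+ 2 * w)%:E.
  apply: cvg_EFin; first exact: nearW.
  by apply: cvgB; apply: cvgMr.
rewrite -(cvg_limn_einf_sup h).1.
by apply: le_limn_einf => n; exact: alpha_ge_affine.
Qed.

(** Bounded weights turn an action bound into an L2 bound on the flux. Positivity of [M] keeps the
    right side infinite when [alpha] is, as [0 * +oo = 0]. *)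
Lemma sqr_le_alpha v w M : 0 <= w <= M -> 0 < M -> ((v ^+ 2)%:E <= M%:E * alpha v w)%E.
Proof.
move=> /andP[]; rewrite le_eqVlt /alpha => /predU1P[<-|w0] wM M0.
  rewrite ltxx eqxx andbT; case: eqP => [->|_]; first by rewrite expr0n/= mule0.
  by rewrite gt0_muley ?lte_fin// leey.
rewrite w0 -EFinM lee_fin mulrA ler_pdivlMr// mulrC.
by rewrite ler_wpM2r ?sqr_ge0.
Qed.

Lemma measurable_alpha (dd : measure_display) (X : measurableType dd) (D : set X)
    (v w : X -> R) : measurable D -> measurable_fun D v -> measurable_fun D w ->
  measurable_fun D (fun t => alpha (v t) (w t)).
Proof.
move=> mD mv mw; apply: measurable_fun_if => //.
- by apply: measurable_fun_ltr.
(* On this branch [w > 0], so the inverse can be traded for a real power, which is measurable on the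
   whole line. *)
- apply: (@eq_measurable_fun _ _ _ _ _ (fun t => (v t ^+ 2 * w t `^ (-1))%:E)).
    by move=> t; rewrite inE => -[_ /= wt]; rewrite powR_inv1 ?ltW.
  apply: (@measurable_funS _ _ _ _ D) => //.
  apply/measurable_EFinP; apply: measurable_funM; first exact: measurable_funX.
  by apply: (@measurableT_comp _ _ _ _ _ _ (fun x => x `^ (-1))).
- apply: (@measurable_funS _ _ _ _ D) => //.
  apply: measurable_fun_if => //.
  by apply: measurable_and; apply: measurable_fun_eqr.
Qed.

End Alpha.

(** * Riesz-Fischer convergence of fast Cauchy sequences in L1 *)

Section FastL1.
Context {dd : measure_display} {X : measurableType dd} {R : realType}.
Variables (mu : {measure set X -> \bar R}) (D : set X).
Hypothesis mD : measurable D.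
Local Open Scope ereal_scope.

(** The increments have a geometrically convergent sum of L1 norms, so the sum [G] of [|f 0|] and
    all absolute increments is integrable. Finiteness of [G] almost everywhere gives pointwise
    convergence, and [G] itself is the majorant for dominated convergence. *)
Lemma fast_L1_cauchy_cvg (f : nat -> X -> R) (C : R) :
  (forall n, measurable_fun D (f n)) ->
  \int[mu]_(t in D) `|f 0%N t|%:E < +oo ->
  (forall n, \int[mu]_(t in D) `|f n.+1 t - f n t|%:E <= (C / 2 ^+ n.+1)%:E) ->
  exists g : X -> R, [/\ mu.-integrable D (EFin \o g),
    {ae mu, forall t, D t -> (f ^~ t) @ \oo --> g t} &
    (fun n => \int[mu]_(t in D) `|f n t - g t|%:E) @ \oo --> 0].
Proof.
move=> mf f0 ff.
pose df n t : \bar R := `|f n.+1 t - f n t|%:E.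
have mdf n : measurable_fun D (df n).
  by apply/measurable_EFinP; apply: measurableT_comp => //; exact: measurable_funB.
have df0 n t : 0 <= df n t by rewrite lee_fin.
pose G t := `|f 0%N t|%:E + \sum_(0 <= n <oo) df n t.
have mf0 : measurable_fun D (fun t => `|f 0%N t|%:E).
  by apply/measurable_EFinP; apply: measurableT_comp.
have ms : measurable_fun D (fun t => \sum_(0 <= n <oo) df n t).
  by apply: ge0_emeasurable_sum.
have mG : measurable_fun D G by exact: emeasurable_funD.
have G0 t : 0 <= G t by rewrite adde_ge0// nneseries_ge0.
have iG : mu.-integrable D G.
  apply/integrableP; split => //.
  under eq_integral do rewrite gee0_abs//.
  rewrite ge0_integralD//; last by move=> t _; exact: nneseries_ge0.
  rewrite lte_add_pinfty// integral_nneseries//.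
  apply: (@le_lt_trans _ _ (\sum_(0 <= n <oo) (C / 2 ^+ n.+1)%:E)).
    by apply: lee_nneseries => [n _ _|n _]; [exact: integral_ge0|exact: ff].
  have := @cvg_geometric_eseries_half R C 0; rewrite expr0 divr1.
  have -> : (fun k => (C / (2 ^ (k + 1))%:R)%:E) = (fun n => (C / 2 ^+ n.+1)%:E).
    by apply/funext => n; rewrite addn1 natrX.
  by move=> /(cvg_lim _) ->//; rewrite ltry.
have fG n t : `|f n t|%:E <= G t.
  apply: (@le_trans _ _ (`|f 0%N t|%:E + \sum_(0 <= k < n) df k t)); last first.
    by rewrite leeD2l// nneseries_lim_ge.
  rewrite sumEFin -EFinD lee_fin.
  have -> : f n t = (f 0%N t + \sum_(0 <= k < n) (f k.+1 t - f k t))%R.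
    by rewrite (telescope_sumr (f ^~ t))// addrC subrK.
  by rewrite (le_trans (ler_normD _ _))// lerD2l ler_norm_sum.
(* An upper limit is measurable on all of [D], including the null set without convergence, where
   [fine] supplies some real value. *)
pose g t : R := fine (limn_esup (fun n => (f n t)%:E)).
have mg : measurable_fun D g.
  apply: (@measurableT_comp _ _ _ _ _ _ fine); first exact: fine_measurable.
  by apply: measurable_fun_limn_esup => n; exact/measurable_EFinP.
have fg : {ae mu, forall t, D t -> (f ^~ t) @ \oo --> g t}.
  apply: filterS (integrable_ae mD iG) => t Gt /Gt Gfin.
  have cf : cvgn (f ^~ t).
    have cs : cvgn [normed series (fun n => f n.+1 t - f n t)%R].
      apply: nondecreasing_is_cvgn.
        by apply: nondecreasing_series => n _ _ /=.
      exists (fine (G t)) => _ [n _ <-]; rewrite -lee_fin fineK//=.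
      rewrite -sumEFin; apply: (@le_trans _ _ (\sum_(0 <= k <oo) df k t)).
        by rewrite nneseries_lim_ge.
      by rewrite leeDr.
    have -> : f ^~ t = (fun n => f 0%N t + series (fun n => f n.+1 t - f n t)%R n)%R.
      by apply/funext => n; rewrite /series/= (telescope_sumr (f ^~ t))// addrC subrK.
    by apply: is_cvgD; [exact: is_cvg_cst|exact: normed_cvg].
  have cE : (fun n => (f n t)%:E) @ \oo --> (limn (f ^~ t))%:E.
    by apply: cvg_EFin => //; exact: nearW.
  by rewrite /g (cvg_limn_einf_sup cE).2.
have [| | | |ig h _] := @dominated_convergence _ _ R mu D mD
    (fun n t => (f n t)%:E) (EFin \o g) G _ _ _ iG _.
- by move=> n; exact/measurable_EFinP.
- exact/measurable_EFinP.
- apply: filterS fg => t ft Dt; apply: cvg_EFin; [exact: nearW|exact: ft].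
- by apply: aeW => t n Dt; rewrite abse_EFin.
- by exists g; split.
Qed.
End FastL1.

(** * Almost minimal elements of decreasing convex sets in L2 *)

Section Mazur.
Context {dd : measure_display} {X : measurableType dd} {R : realType}.
Variables (mu : {measure set X -> \bar R}) (D : set X).
Hypothesis mD : measurable D.
Hypothesis muD : (mu D < +oo)%E.
Context {I : finType}.
Implicit Types u w : X -> I -> R.

Definition sqnorm u : \bar R := (\int[mu]_(t in D) (\sum_i u t i ^+ 2)%:E)%E.

Definition midpoint u w : X -> I -> R := fun t i => 2^-1 * (u t i + w t i).

Let measurable_sqR u : (forall i, measurable_fun D (u ^~ i)) ->
  measurable_fun D (fun t => \sum_i u t i ^+ 2).
Proof. by move=> mu_; apply: measurable_sum => i; exact: measurable_funX. Qed.

Let sqR_ge0 u t : 0 <= \sum_i u t i ^+ 2.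
Proof. by rewrite sumr_ge0// => i _; exact: sqr_ge0. Qed.

Let integralD_ge0 (f g : X -> R) : measurable_fun D f -> measurable_fun D g ->
  (forall t, 0 <= f t) -> (forall t, 0 <= g t) ->
  (\int[mu]_(t in D) (f t)%:E + \int[mu]_(t in D) (g t)%:E =
   \int[mu]_(t in D) (f t + g t)%:E)%E.
Proof.
move=> mf mg f0 g0; rewrite -ge0_integralD// => [t _||t _|].
- by rewrite lee_fin.
- exact/measurable_EFinP.
- by rewrite lee_fin.
- exact/measurable_EFinP.
Qed.

Let integralZ_ge0 (k : R) (f : X -> R) : 0 <= k -> measurable_fun D f ->
  (forall t, 0 <= f t) ->
  (k%:E * \int[mu]_(t in D) (f t)%:E = \int[mu]_(t in D) (k * f t)%:E)%E.
Proof.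
move=> k0 mf f0; rewrite -ge0_integralZl_EFin// => [t _|].
- by rewrite lee_fin.
- exact/measurable_EFinP.
Qed.

Lemma sqnorm_ge0 u : (0 <= sqnorm u)%E.
Proof. by apply: integral_ge0 => t _; rewrite lee_fin. Qed.

(** Stated with sums only, so that it holds for infinite norms too; the factor 4 comes from using
    the midpoint instead of the sum. *)
Lemma parallelogram u w :
  (forall i, measurable_fun D (u ^~ i)) -> (forall i, measurable_fun D (w ^~ i)) ->
  (sqnorm (fun t i => (w t i - u t i)%R) + 4%:E * sqnorm (midpoint u w) =
   2%:E * (sqnorm u + sqnorm w))%E.
Proof.
move=> mu_ mw_.
have md i : measurable_fun D (fun t => w t i - u t i) by exact: measurable_funB.
have mm i : measurable_fun D (fun t => midpoint u w t i).
  by apply: measurable_funM => //; exact: measurable_funD.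
have [[[sd sm] su] sw] := (measurable_sqR _ md, measurable_sqR _ mm,
  measurable_sqR _ mu_, measurable_sqR _ mw_).
have nn u' : forall t, 0 <= \sum_i u' t i ^+ 2 by move=> t; exact: sqR_ge0.
rewrite /sqnorm (integralZ_ge0 4)// integralD_ge0//; first last.
- by move=> t; rewrite mulr_ge0.
- exact: (nn (fun t i => w t i - u t i)).
- exact: measurable_funM.
rewrite integralD_ge0// integralZ_ge0//; first last.
- by move=> t; rewrite addr_ge0.
- exact: measurable_funD.
apply: eq_integral => t _; congr EFin.
rewrite -big_split/= !mulr_sumr -big_split/=; apply: eq_bigr => i _.
by rewrite /midpoint; field.
Qed.

Let muDE : mu D = (fine (mu D))%:E.
Proof. by rewrite fineK// ge0_fin_numE. Qed.

(** Young's inequality [|x| <= a/2 + x^2/(2a)], a substitute for Cauchy-Schwarz. The parameter [a]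
    stays free and is tuned at each use. *)
Lemma integral_abs_le_sqnorm u (a : R) i : 0 < a -> (forall i, measurable_fun D (u ^~ i)) ->
  (\int[mu]_(t in D) `|u t i|%:E <= (2^-1 * a)%:E * mu D + (2^-1 / a)%:E * sqnorm u)%E.
Proof.
move=> a0 mu_.
have aV0 : 0 <= 2^-1 / a by rewrite mulr_ge0// invr_ge0 ltW.
rewrite /sqnorm -integral_cst// integralZ_ge0//; last exact: measurable_sqR.
have ma : measurable_fun D (fun t => 2^-1 / a * \sum_i u t i ^+ 2).
  by apply: measurable_funM => //; exact: measurable_sqR.
rewrite integralD_ge0//; first last.
- by move=> t; rewrite mulr_ge0.
- by move=> t; rewrite mulr_ge0// ltW.
apply: ge0_le_integral => //.
- by apply/measurable_EFinP; apply: measurableT_comp.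
- by apply/measurable_EFinP; exact: measurable_funD.
move=> t _; rewrite lee_fin.
apply: (@le_trans _ _ (2^-1 * a + 2^-1 / a * `|u t i| ^+ 2)).
  have : 0 <= 2^-1 / a * (`|u t i| - a) ^+ 2 by rewrite mulr_ge0 ?sqr_ge0.
  have -> : 2^-1 / a * (`|u t i| - a) ^+ 2 =
    2^-1 * a + 2^-1 / a * `|u t i| ^+ 2 - `|u t i| by field; rewrite gt_eqF.
  by rewrite subr_ge0.
rewrite lerD2l ler_wpM2l// real_normK ?num_real// (bigD1 i)//= lerDl.
by rewrite sumr_ge0// => j _; exact: sqr_ge0.
Qed.

(* The elements of almost minimal norm of the sets [K n] form a Cauchy sequence
   by the parallelogram identity; this replaces weak compactness in L2. *)
Lemma mazur_ae (K : nat -> set (X -> I -> R)) (B : R) :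
  (forall n, K n !=set0) ->
  (forall n m, (n <= m)%N -> K m `<=` K n) ->
  (forall n u w, K n u -> K n w -> K n (midpoint u w)) ->
  (forall n u, K n u -> forall i, measurable_fun D (u ^~ i)) ->
  (forall n u, K n u -> (sqnorm u <= B%:E)%E) ->
  exists (u : nat -> X -> I -> R) (v : X -> I -> R),
    (forall n, K n (u n)) /\
    forall i, [/\ mu.-integrable D (EFin \o v ^~ i),
      {ae mu, forall t, D t -> (fun n => u n t i) @ \oo --> v t i} &
      ((fun n => \int[mu]_(t in D) `|u n t i - v t i|%:E) @ \oo --> 0)%E].
Proof.
move=> K0 Kdec Kmid Km KB.
pose h u := fine (sqnorm u).
have hE n u : K n u -> sqnorm u = (h u)%:E.
  move=> Ku; rewrite fineK// ge0_fin_numE ?sqnorm_ge0//.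
  by rewrite (le_lt_trans (KB _ _ Ku))// ltry.
have h0 u : 0 <= h u by rewrite fine_ge0// sqnorm_ge0.
have hB n u : K n u -> h u <= B by move=> Ku; rewrite -lee_fin -(hE _ _ Ku); exact: KB Ku.
pose d n := inf (h @` K n).
have hasd n : has_inf (h @` K n).
  split; first by have [u Ku] := K0 n; exists (h u), u.
  by exists 0 => _ [u _ <-].
have dlb n u : K n u -> d n <= h u.
  by move=> Ku; apply: ge_inf; [exact: (hasd n).2|exists u].
have dnd n m : (n <= m)%N -> d n <= d m.
  move=> nm; apply: lb_le_inf; first exact: (hasd m).1.
  by move=> _ [u Ku <-]; apply: dlb; exact: Kdec Ku.
have hasD : has_sup (range d).
  split; first by exists (d 0%N), 0%N.
  exists B => _ [n _ <-]; have [u Ku] := K0 n.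
  by rewrite (le_trans (dlb _ _ Ku))// (hB n).
pose s := sup (range d).
have ds n : d n <= s by apply: sup_upper_bound => //; exists n.
(* These are errors of squared norms; [4^-j] makes the L2 distances, hence the L1 distances, of
   order [2^-j]. *)
pose e j : R := 4^-1 ^+ j.
have e0 j : 0 < e j by rewrite exprn_gt0// invr_gt0.
have eS j : e j.+1 = 4^-1 * e j by rewrite /e exprS.
have /choice[f Hf] j : exists p : nat * (X -> I -> R),
    [/\ (j <= p.1)%N, K p.1 p.2, s - e j < d p.1 & h p.2 <= s + e j].
  have [_ [N _ <-] sN] := sup_adherent (e0 j) hasD.
  have [_ [u Ku <-] hu] := inf_adherent (e0 j) (hasd (maxn N j)).
  (* Beyond [N] the infimum is close to its limit [s]; beyond [j] the chosen element lies in
     [K j]. *)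
  exists (maxn N j, u); split => //=; first exact: leq_maxr.
    by rewrite (lt_le_trans sN)// dnd// leq_maxl.
  by rewrite ltW// (lt_le_trans hu)// lerD2r ds.
pose u j := (f j).2.
have Ku j : K j (u j) by have [jp Kp _ _] := Hf j; exact: Kdec jp _ Kp.
have mu_ j i : measurable_fun D (u j ^~ i) by exact: Km (Ku j) i.
(* The midpoint stays in the larger of the two sets, so its squared norm exceeds [s - e j], while
   the endpoints have at most [s + e j] and [s + e j / 4]. The parallelogram identity leaves at most
   [6.5 * e j]. *)
have cauchy j : (sqnorm (fun t i => u j.+1 t i - u j t i)%R <= (8 * e j)%:E)%E.
  have [_ K1 d1 h1] := Hf j; have [_ K2 d2 h2] := Hf j.+1.
  pose m := minn (f j).1 (f j.+1).1.
  have Km1 : K m (midpoint (u j) (u j.+1)).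
    by apply: Kmid; [apply: Kdec K1; exact: geq_minl|apply: Kdec K2; exact: geq_minr].
  have dm : s - e j < d m.
    rewrite /m /minn; case: ifPn => // _; apply: lt_trans d2.
    by rewrite ltrD2l ltrN2 eS; have := e0 j; lra.
  have hm := dlb _ _ Km1.
  have := parallelogram _ _ (mu_ j) (mu_ j.+1).
  rewrite (hE _ _ Km1) (hE _ _ (Ku j)) (hE _ _ (Ku j.+1)).
  move=> /(congr1 (fun x => x - 4%:E * (h (midpoint (u j) (u j.+1)))%:E)%E).
  rewrite addeK// => ->.
  rewrite -[X in (X <= _)%E]/((2 * (h (u j) + h (u j.+1)) -
    4 * h (midpoint (u j) (u j.+1)))%:E) lee_fin.
  by move: h1 h2 (e0 j); rewrite eS /u; lra.
(* Young's inequality with [a = 2^-n] and squared norm [8 * 4^-n] gives exactly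
   [(mu D + 8) / 2^(n+1)]. *)
pose C := fine (mu D) + 8.
have L1 i : exists g : X -> R, [/\ mu.-integrable D (EFin \o g),
    {ae mu, forall t, D t -> (fun n => u n t i) @ \oo --> g t} &
    ((fun n => \int[mu]_(t in D) `|u n t i - g t|%:E) @ \oo --> 0)%E].
  apply: (@fast_L1_cauchy_cvg _ _ _ _ _ mD (fun n t => u n t i) C) => //.
    apply: (le_lt_trans (integral_abs_le_sqnorm _ _ i ltr01 (mu_ 0%N))).
    by rewrite muDE (hE _ _ (Ku 0%N)) -!EFinM -EFinD ltry.
  move=> n; have a0 : 0 < (2^-1 : R) ^+ n by rewrite exprn_gt0// invr_gt0.
  have md j : measurable_fun D (fun t => u n.+1 t j - u n t j).
    exact: measurable_funB.
  apply: (le_trans (integral_abs_le_sqnorm _ _ i a0 md)).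
  rewrite muDE -EFinM.
  apply: (@le_trans _ _ ((2^-1 * 2^-1 ^+ n * fine (mu D))%:E +
     (2^-1 / 2^-1 ^+ n)%:E * (8 * e n)%:E)%E).
    rewrite leeD2l// lee_wpmul2l// lee_fin mulr_ge0// invr_ge0 ltW//.
  rewrite -EFinM -EFinD lee_fin.
  have -> : e n = (2^-1 ^+ n) ^+ 2.
    by rewrite /e -exprM mulnC exprM; congr (_ ^+ _); field.
  rewrite /C (exprS 2) exprVn le_eqVlt; apply/orP; left; apply/eqP.
  have : (2 : R) ^+ n != 0 by rewrite expf_neq0.
  by move: (2 ^+ n) (fine (mu D)) => p m p0; field; rewrite p0.
have [v Hv] := choice L1.
by exists u, (fun t i => v i t); split.
Qed.

End Mazur.

(** * Explicit C^1 test functions built from squared positive parts *)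

Section TestFunctions.
Context {R : realType}.
Implicit Types (x y h a b s t T : R).
Local Notation mu := (@lebesgue_measure R).

(** Suited to the square of [pospart], whose first order remainder lies between 0 and [h^2] even
    across the kink. *)
Lemma quadratic_is_derive (f : R -> R) x (l K : R) :
  (forall h, `|f (h + x) - f x - l * h| <= K * h ^+ 2) -> is_derive x 1 f l.
Proof.
move=> fK.
have cv : (fun h => h^-1 *: (f (h *: 1 + x) - f x)) @ 0^' --> l.
  apply/cvgrPdist_lt => e e0.
  have d0 : 0 < e / (`|K| + 1) by rewrite divr_gt0// ltr_wpDl.
  exists (e / (`|K| + 1)) => //= h; rewrite /= sub0r normrN => hd h0.
  rewrite -[h%:A]/(h * 1) mulr1 -[_ *: _]/(_ * _).
  have -> : l - h^-1 * (f (h + x) - f x) = - (h^-1 * (f (h + x) - f x - l * h)).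
    by field.
  rewrite normrN normrM normfV mulrC ltr_pdivrMr ?normr_gt0//.
  apply: (le_lt_trans (fK h)); rewrite -[h ^+ 2]real_normK ?num_real// expr2 mulrA.
  rewrite ltr_pM2r ?normr_gt0//; apply: le_lt_trans (_ : (`|K| + 1) * `|h| < e).
    by rewrite ler_wpM2r// (le_trans (ler_norm K))// lerDl.
  by rewrite mulrC -ltr_pdivlMr// ltr_wpDl.
apply: DeriveDef; first by apply/cvg_ex; exists l.
exact: cvg_lim cv.
Qed.

Definition pospart x : R := Num.max 0 x.

Lemma pospart_cont : continuous pospart.
Proof. by move=> x; apply: continuous_max => //; exact: cvg_cst. Qed.

(* A C^1 step from 0 (for [x <= 0]) to 1 (for [2h <= x]); its derivative is the
   hat function of mass 1 supported in [0, 2h]. *)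
Definition ramp h x : R :=
  (pospart x ^+ 2 - 2 * pospart (x - h) ^+ 2 + pospart (x - 2 * h) ^+ 2) / (2 * h ^+ 2).

Definition hat h x : R :=
  (pospart x - 2 * pospart (x - h) + pospart (x - 2 * h)) / h ^+ 2.

Lemma ramp_is_derive h a x : 0 < h -> is_derive x 1 (fun y => ramp h (y - a)) (hat h (x - a)).
Proof.
move=> h0.
have D b : is_derive x 1 (fun y => pospart (y - b) ^+ 2) (2 * pospart (x - b)).
  apply: (@quadratic_is_derive _ _ _ 1) => k; rewrite ler_norml /pospart mul1r.
  by case: (leP 0 (k + x - b)); case: (leP 0 (x - b)) => *; apply/andP; split; nra.
have -> : (fun y => ramp h (y - a)) = (fun y => (2 * h ^+ 2)^-1 *
    (pospart (y - a) ^+ 2 - 2 * pospart (y - (a + h)) ^+ 2 +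
     pospart (y - (a + 2 * h)) ^+ 2)).
  by apply/funext => y; rewrite /ramp mulrC !opprD !addrA.
have Da := D a; have Db := D (a + h); have Dc := D (a + 2 * h).
apply: is_derive_eq; rewrite /GRing.scale/= /hat !opprD !addrA; field.
by rewrite gt_eqF.
Qed.

Lemma ramp_eq0 h x : 0 < h -> x <= 0 -> ramp h x = 0.
Proof.
move=> h0 x0; have p y : y <= 0 -> pospart y = 0 by move=> y0; apply/max_idPl.
by rewrite /ramp !p ?expr0n/= ?mulr0 ?subr0 ?addr0 ?mul0r//; lra.
Qed.

Lemma ramp_eq1 h x : 0 < h -> 2 * h <= x -> ramp h x = 1.
Proof.
move=> h0 x0; have p y : 0 <= y -> pospart y = y by move=> y0; apply/max_idPr.
rewrite /ramp !p; [|lra..].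
by field; rewrite gt_eqF.
Qed.

Lemma ramp_bound h x : 0 < h -> 0 <= ramp h x <= 1.
Proof.
move=> h0; have h2 : 0 < 2 * h ^+ 2 by rewrite mulr_gt0 ?exprn_gt0.
rewrite /ramp divr_ge0 ?(ltW h2)//= ?ler_pdivrMr ?mul1r// /pospart;
case: (leP 0 x); case: (leP 0 (x - h)); case: (leP 0 (x - 2 * h)) => *; nra.
Qed.

Lemma hat_ge0 h x : 0 < h -> 0 <= hat h x.
Proof.
move=> h0; rewrite /hat divr_ge0 ?sqr_ge0// /pospart.
case: (leP 0 x); case: (leP 0 (x - h)); case: (leP 0 (x - 2 * h)) => *; lra.
Qed.

Lemma hat_eq0 h x : 0 < h -> x < 0 \/ 2 * h < x -> hat h x = 0.
Proof.
move=> h0 hx; apply/eqP; rewrite mulf_eq0; apply/orP; left; apply/eqP.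
rewrite /pospart.
by case: (leP 0 x); case: (leP 0 (x - h)); case: (leP 0 (x - 2 * h)) => *; lra.
Qed.

Lemma hat_cont h a : continuous (fun y => hat h (y - a)).
Proof.
have P b : continuous (fun y => pospart (y - b)).
  move=> y; have yb : (fun z => z - b) @ y --> y - b.
    by apply: cvgB; [exact: cvg_id|exact: cvg_cst].
  exact: (cvg_comp _ _ yb (pospart_cont _)).
move=> y; apply: cvgMl; apply: cvgD.
  apply: cvgB; first exact: P.
  apply: cvgMr.
  have -> : (fun z => pospart (z - a - h)) = (fun z => pospart (z - (a + h))).
    by apply/funext => z; rewrite opprD addrA.
  rewrite -addrA -opprD; exact: P.
have -> : (fun z => pospart (z - a - 2 * h)) = (fun z => pospart (z - (a + 2 * h))).
  by apply/funext => z; rewrite opprD addrA.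
rewrite -addrA -opprD; exact: P.
Qed.

(** The shifted ramp is an antiderivative, and the position of the support makes it 0 at time 0 and
    1 at time [T]. *)
Lemma hat_mass h a T : 0 < h -> 0 < T -> 0 <= a -> a + 2 * h <= T ->
  Rintegral mu `[0, T] (fun t => hat h (t - a)) = 1.
Proof.
move=> h0 T0 a0 aT; rewrite /Rintegral.
have dR x : derivable (fun y => ramp h (y - a)) x 1.
  by have [] := ramp_is_derive h a x h0.
have cR : continuous (fun y => ramp h (y - a)).
  by move=> x; apply/differentiable_continuous/derivable1_diffP/dR.
rewrite (@continuous_FTC2 _ _ (fun y => ramp h (y - a)))//.
- by rewrite -EFinB/= ramp_eq1; [rewrite ramp_eq0; [rewrite subr0|..]|..]; lra.
- exact/continuous_subspaceT/hat_cont.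
- split; first by move=> x _; exact: dR.
  + exact/cvg_at_right_filter/cR.
  + exact/cvg_at_left_filter/cR.
- by move=> x _; rewrite derive1E; have [_ ->] := ramp_is_derive h a x h0.
Qed.

(** A smoothed indicator function, rising on [[a, a + 2h]] and falling on [[b, b + 2h]]; integrating
    its derivative against a curve compares averages near [a] and near [b]. *)
Lemma C1c_ramps h a b T : 0 < h -> 0 < a -> a <= b -> b + 2 * h < T ->
  C1c T (fun t => ramp h (t - a) - ramp h (t - b)) /\
  derive1 (fun t => ramp h (t - a) - ramp h (t - b)) =
    (fun t => hat h (t - a) - hat h (t - b)).
Proof.
move=> h0 a0 ab bT.
have dE x : is_derive x 1 (fun t => ramp h (t - a) - ramp h (t - b))
    (hat h (x - a) - hat h (x - b)).
  by have Da := ramp_is_derive h a x h0; have Db := ramp_is_derive h b x h0;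
    apply: is_derive_eq.
have d1 : derive1 (fun t => ramp h (t - a) - ramp h (t - b)) =
    (fun t => hat h (t - a) - hat h (t - b)).
  by apply/funext => x; rewrite derive1E; have [_ ->] := dE x.
split=> //; split; first by move=> t; have [] := dE t.
split; first by rewrite d1 => t; apply: cvgB; exact: hat_cont.
exists a, (b + 2 * h); split=> //; split; first by lra.
split=> // t [ta|tb].
  by rewrite !ramp_eq0 ?subrr//; lra.
by rewrite !ramp_eq1 ?subrr//; lra.
Qed.

End TestFunctions.

(** * Increments of a curve controlled by its weak derivative *)

Lemma within_continuousP {R : realType} (A : set R) (f : R -> R) :
  {within A, continuous f} <->
  forall x, A x -> forall e, 0 < e -> exists2 d, 0 < d &
    forall y, A y -> `|y - x| < d -> `|f y - f x| < e.
Proof.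
rewrite subspace_continuousP; split => [cf x Ax e e0|cf x Ax].
  have /cvgrPdist_lt/(_ _ e0) := cf x Ax.
  move=> [d /= d0 hd]; exists d => // y Ay yx.
  by have := hd y; rewrite /= distrC yx => /(_ isT Ay); rewrite distrC.
apply/cvgrPdist_lt => e e0; have [d d0 hd] := cf x Ax e e0.
by exists d => //= y yx Ay; rewrite distrC hd// distrC.
Qed.

Section Increment.
Context {R : realType}.
Implicit Types (a h s t T e : R) (c g : R -> R).
Local Notation mu := (@lebesgue_measure R).

Lemma within_continuous_integrable a b (f : R -> R) :
  {within `[a, b], continuous f} -> mu.-integrable `[a, b] (EFin \o f).
Proof. by apply: continuous_compact_integrable; exact: segment_compact. Qed.

Lemma hat_average T h a l e c : 0 < h -> 0 < T -> 0 <= a -> a + 2 * h <= T ->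
  {within `[0, T], continuous c} ->
  (forall r, a <= r <= a + 2 * h -> `|c r - l| <= e) ->
  `|Rintegral mu `[0, T] (fun t => hat h (t - a) * c t) - l| <= e.
Proof.
move=> h0 T0 a0 aT cc cl.
have wc : {within `[0, T], continuous (fun t => hat h (t - a))}.
  exact/continuous_subspaceT/hat_cont.
have wM (f : R -> R) : {within `[0, T], continuous f} ->
    {within `[0, T], continuous (fun t => hat h (t - a) * f t)}.
  by move=> cf x; apply: cvgM; [exact: wc|exact: cf].
have iM f wf := within_continuous_integrable _ _ _ (wM f wf).
have wcst (k : R) : {within `[0, T], continuous (fun=> k)}.
  exact/continuous_subspaceT/cst_continuous.
have wB : {within `[0, T], continuous (fun t => c t - l)}.
  by move=> x; apply: cvgB; [exact: cc|exact: cvg_cst].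
have massZ k : Rintegral mu `[0, T] (fun t => hat h (t - a) * k) = k.
  by rewrite RintegralZr ?hat_mass ?mul1r//; exact: within_continuous_integrable.
rewrite -[X in _ - X]massZ -RintegralB//; [|exact: iM..].
under eq_Rintegral do rewrite -mulrBr.
apply: (le_trans (le_normr_Rintegral _ _)) => //; first exact: iM.
rewrite -[leRHS]massZ; apply: le_Rintegral => //; [|exact: iM|].
  have := integrable_norm (iM _ wB); exact.
move=> r _; rewrite normrM ger0_norm ?hat_ge0//.
have [ra|ra] := ltP (r - a) 0; first by rewrite hat_eq0 ?mul0r//; left.
have [ra2|ra2] := ltP (2 * h) (r - a); first by rewrite hat_eq0 ?mul0r//; right.
by rewrite ler_wpM2l ?hat_ge0// cl//; apply/andP; split; lra.
Qed.

(** Test with a smoothed indicator supported inside [[s, t]] and bounded by 1: the [g] term is at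
    most the integral of [|g|] over [[s, t]], and the two hats reproduce [c s] and [c t] up to
    [e / 2] each. *)
Lemma weak_derivative_increment T c g s t : 0 < T ->
  {within `[0, T], continuous c} ->
  mu.-integrable `[0, T] (EFin \o g) ->
  (forall phi, C1c T phi ->
     Rintegral mu `[0, T] (fun r => derive1 phi r * c r - phi r * g r) = 0) ->
  0 <= s -> s < t -> t <= T ->
  `|c t - c s| <= Rintegral mu `[s, t] (fun r => `|g r|).
Proof.
move=> T0 cc ig weak s0 st tT; apply/ler_addgt0Pr => e e0.
have e20 : 0 < e / 2 by rewrite divr_gt0.
have Is : `[0, T]%classic s by rewrite /= in_itv/= s0 (le_trans (ltW st)).
have It : `[0, T]%classic t by rewrite /= in_itv/= tT (le_trans s0 (ltW st)).
have [d1 d10 hd1] := (within_continuousP _ _).1 cc s Is _ e20.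
have [d2 d20 hd2] := (within_continuousP _ _).1 cc t It _ e20.
pose h := Num.min (Num.min d1 d2) (t - s) / 6.
have m0 : 0 < Num.min (Num.min d1 d2) (t - s) by rewrite !lt_min d10 d20 subr_gt0.
have h0 : 0 < h by rewrite divr_gt0.
have [h1 h2 h3] : [/\ 6 * h <= d1, 6 * h <= d2 & 6 * h <= t - s].
  by rewrite /h mulrC divfK//; split; rewrite !ge_min lexx ?orbT.
(* The bump lives on [[s + h, t - h]], hence strictly inside [(0, T)] even for [s = 0] or [t = T].
   The averaging windows end at distance [3h] from [s] and [t], below [d1] and [d2]; [a <= b] uses
   [4h <= t - s]. *)
pose a := s + h; pose b := t - 3 * h.
have a0 : 0 < a by rewrite /a; lra.
have ab : a <= b by rewrite /a /b; lra.
have bT : b + 2 * h < T by rewrite /b; lra.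
have [Cphi dphi] := C1c_ramps h a b T h0 a0 ab bT.
set phi := (fun r => ramp h (r - a) - ramp h (r - b)) in Cphi dphi.
have := weak _ Cphi; rewrite dphi.
have wh x : {within `[0, T], continuous (fun r => hat h (r - x) * c r)}.
  move=> y; apply: cvgM; last exact: cc.
  exact: (continuous_subspaceT (@hat_cont R h x)).
have ih x := within_continuous_integrable _ _ _ (wh x).
have phi1 r : `|phi r| <= 1.
  have /andP[x0 x1] := ramp_bound h (r - a) h0.
  by have /andP[y0 y1] := ramp_bound h (r - b) h0; rewrite ler_norml /phi; lra.
have mphi A : measurable_fun A phi.
  apply: measurable_funTS; apply: continuous_measurable_fun => x.
  by have [dp _] := Cphi; apply/differentiable_continuous/derivable1_diffP/dp.
have iphig : mu.-integrable `[0, T] (EFin \o (fun r => phi r * g r)).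
  apply: (le_integrable _ _ _ ig) => //.
    have /integrableP[/measurable_EFinP mg _] := ig.
    apply/measurable_EFinP; apply: measurable_funM; [exact: mphi|exact: mg].
  by move=> r _ /=; rewrite lee_fin normrM ler_piMl.
have whab : {within `[0, T], continuous (fun r => (hat h (r - a) - hat h (r - b)) * c r)}.
  have -> : (fun r => (hat h (r - a) - hat h (r - b)) * c r) =
    (fun r => hat h (r - a) * c r - hat h (r - b) * c r).
    by apply/funext => r; rewrite mulrBl.
  by move=> y; apply: cvgB; exact: wh.
rewrite RintegralB//; last exact: within_continuous_integrable.
under eq_Rintegral do rewrite mulrBl.
rewrite RintegralB//; [|exact: ih..] => /eqP; rewrite subr_eq0 => /eqP hphi.
have ha : `|Rintegral mu `[0, T] (fun r => hat h (r - a) * c r) - c s| <= e / 2.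
  apply: hat_average => //; [exact: ltW|by rewrite /a; lra|move=> r /andP[r1 r2]].
  apply/ltW/hd1; first by rewrite /= in_itv/=; apply/andP; rewrite /a in r1 r2; clear -r1 r2 h1 h2 h3 h0 s0 tT st; split; lra.
  by rewrite ltr_norml; apply/andP; rewrite /a in r1 r2; clear -r1 r2 h1 h2 h3 h0 s0 tT st; split; lra.
have hb : `|Rintegral mu `[0, T] (fun r => hat h (r - b) * c r) - c t| <= e / 2.
  apply: hat_average => //; [by rewrite /b; lra|exact: ltW|move=> r /andP[r1 r2]].
  apply/ltW/hd2; first by rewrite /= in_itv/=; apply/andP; rewrite /b in r1 r2; clear -r1 r2 h1 h2 h3 h0 s0 tT st; split; lra.
  by rewrite ltr_norml; apply/andP; rewrite /b in r1 r2; clear -r1 r2 h1 h2 h3 h0 s0 tT st; split; lra.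
have sub : `[s, t] `<=` `[0, T]%classic.
  by move=> r; rewrite /= !in_itv/= => /andP[r1 r2]; apply/andP; split; lra.
have igst : mu.-integrable `[s, t] (EFin \o g) by exact: integrableS ig.
have hI : `|Rintegral mu `[0, T] (fun r => phi r * g r)| <=
    Rintegral mu `[s, t] (fun r => `|g r|).
  have -> : Rintegral mu `[0, T] (fun r => phi r * g r) =
      Rintegral mu `[s, t] (fun r => phi r * g r).
    rewrite [LHS]Rintegral_mkcond [RHS]Rintegral_mkcond; congr Rintegral.
    apply/funext => r; rewrite /patch.
    case: ifPn => rT; case: ifPn => rst //.
      rewrite /phi; move: rst; rewrite notin_setE/= in_itv/= => rst.
      have [rs|rs] := ltP r s; first by rewrite !ramp_eq0 ?subrr ?mul0r// /a /b; lra.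
      have [rt|rt] := ltP t r; first by rewrite !ramp_eq1 ?subrr ?mul0r// /a /b; lra.
      by exfalso; apply: rst; rewrite rs.
    by move: rT; rewrite notin_setE => rT; exfalso; apply/rT/sub; move: rst; rewrite inE.
  have ist : mu.-integrable `[s, t] (EFin \o (fun r => phi r * g r)).
    exact: integrableS iphig.
  apply: (le_trans (le_normr_Rintegral _ _)) => //.
  apply: le_Rintegral => //; [exact: (integrable_norm ist)|exact: (integrable_norm igst)|].
  by move=> r _; rewrite normrM ler_piMl.
rewrite -hphi in hI; move: hI ha hb; rewrite !ler_norml.
move: (Rintegral mu `[0, T] _) (Rintegral mu `[0, T] _) (Rintegral mu _ _) => x y z.
by move=> /andP[? ?] /andP[? ?] /andP[? ?]; apply/andP; split; lra.
Qed.

End Increment.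

(** * Arzela-Ascoli from Tychonoff *)

Section Subsequence.
Context {R : realType} (I : finType).
Implicit Types (T C e d : R).

(* A Tychonoff cluster point of the pairs (curve, scalar) is, by
   equicontinuity, a uniform one; this yields Arzela-Ascoli in sequential form
   together with the convergence of the scalars. *)
Lemma equicontinuous_subsequence T C (c : nat -> R -> I -> R) (A : nat -> R) :
  (forall k t i, t \in `[0, T] -> 0 <= c k t i <= 1) ->
  (forall k, 0 <= A k <= C) ->
  (forall e, 0 < e -> exists2 d, 0 < d & forall k s t i, s \in `[0, T] ->
     t \in `[0, T] -> `|s - t| < d -> `|c k s i - c k t i| <= e) ->
  exists (phi : nat -> nat) (c0 : R -> I -> R) (a : R),
    [/\ {homo phi : n m / (n < m)%N},
        forall n t i, t \in `[0, T] -> `|c (phi n) t i - c0 t i| <= n.+1%:R^-1 &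
        forall n, `|A (phi n) - a| <= n.+1%:R^-1].
Proof.
move=> c01 AC equi.
(* [None] is the coordinate of the scalar. Coordinates at times outside [[0, T]] are set to 0, so
   that everything stays in one compact box. *)
pose J : eqType := option (R * I)%type.
pose p k (j : J) : R := if j is Some (t, i) then
  (if t \in `[0, T] then c k t i else 0) else A k.
pose M := Num.max 1 C.
have M1 : 1 <= M by rewrite le_max lexx.
have MC : C <= M by rewrite le_max lexx orbT.
have pM k j : p k j \in `[0, M].
  rewrite in_itv/=; case: j => [[t i]|] /=; last first.
    by have /andP[-> h] := AC k; rewrite (le_trans h).
  case: ifPn => [/(c01 k _ i)/andP[-> h]|_]; first by rewrite (le_trans h).
  by rewrite lexx (le_trans _ M1).
have pbox : (p @ \oo) [set f | forall j : J, `[0, M]%classic (f j)].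
  by exists 0%N => // k _ j; exact: pM.
have [q [_ clq]] := @tychonoff J (fun=> R) (fun=> `[0, M]%classic)
  (fun=> @segment_compact _ _ _) (p @ \oo) _ pbox.
(* Being close to [q] on a finite list of coordinates is a product neighbourhood, which every tail
   of [p] meets. *)
have near_list (L : seq J) e N : 0 < e ->
    exists2 k, (N <= k)%N & forall j, j \in L -> `|p k j - q j| < e.
  move=> e0.
  pose q' : prod_topology (fun _ : J => R) := q.
  pose F := nbhs q'; have FF : Filter F := nbhs_filter q'.
  have nj j : F [set f | `|f j - q j| < e].
    have nqj : nbhs (q j) [set y : R | `|y - q j| < e].
      by exists e => //= y; rewrite /ball/= distrC.
    exact: (@proj_continuous J (fun=> R) j q _ nqj).
  have nb : F [set f | forall j, j \in L -> `|f j - q j| < e].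
    clearbody F; elim: L => [|j L IH].
      by apply: (filterS _ (@filterT _ F FF)) => f _ j; rewrite in_nil.
    apply: (filterS _ (filterI (nj j) IH)) => f [/= fj fL] k.
    by rewrite inE => /predU1P[->|/fL].
  have ptail : (p @ \oo) [set p k | k in [set k | (N <= k)%N]].
    by exists N => // k Nk; exists k.
  have [_ [[k /= Nk <-] hk]] := clq _ _ ptail nb.
  by exists k.
pose c0 t i := q (Some (t, i)).
have c0E k t i : t \in `[0, T] -> p k (Some (t, i)) = c k t i by rewrite /= => ->.
have equi0 e : 0 < e -> exists2 d, 0 < d & forall s t i, s \in `[0, T] ->
    t \in `[0, T] -> `|s - t| < d -> `|c0 s i - c0 t i| <= e.
  move=> e0; have [d d0 hd] := equi e e0; exists d => // s t i sT tT st.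
  apply/ler_addgt0Pr => r r0; have r20 : 0 < r / 2 by rewrite divr_gt0.
  have [k _ hk] := near_list [:: Some (s, i); Some (t, i)] _ 0%N r20.
  have := hk (Some (s, i)); rewrite c0E// mem_head => /(_ isT).
  have := hk (Some (t, i)); rewrite c0E// !inE eqxx orbT => /(_ isT).
  have := hd k s t i sT tT st; rewrite /c0.
  rewrite !ler_norml !ltr_norml => /andP[? ?] /andP[? ?] /andP[? ?].
  by apply/andP; split; lra.
(* A grid of mesh [d] is finite. Each time is compared with the grid point below it: the modulus of
   [c k], the error on the grid and the modulus of [c0] contribute [e / 3] each. *)
have key e (N : nat) : 0 < e -> exists k, [/\ (N <= k)%N, `|A k - q None| <= e &
    forall t i, t \in `[0, T] -> `|c k t i - c0 t i| <= e].
  move=> e_gt0; have e0 : 0 < e / 3 by rewrite divr_gt0.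
  have [d1 d10 hd1] := equi _ e0; have [d2 d20 hd2] := equi0 _ e0.
  pose d := Num.min d1 d2; have d0 : 0 < d by rewrite lt_min d10.
  pose L : seq J := None :: [seq Some (m%:R * d, i) | m <- iota 0 (Num.truncn (T / d)).+1, i <- enum I].
  have [k Nk hk] := near_list L _ N e0.
  exists k; split => //.
    by have := hk None; rewrite mem_head => /(_ isT) /ltW/le_trans; apply; lra.
  move=> t i tT; have /andP[t0 tT'] : 0 <= t <= T by move: tT; rewrite in_itv.
  pose m := Num.truncn (t / d).
  have /andP[m1 m2] : m%:R <= t / d < m.+1%:R by apply: truncn_itv; rewrite divr_ge0// ltW.
  have {}m1 : m%:R * d <= t by rewrite -ler_pdivlMr.
  have {}m2 : t < m%:R * d + d by rewrite -[X in _ + X]mul1r -mulrDl natr1 -ltr_pdivrMr.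
  have sT : m%:R * d \in `[0, T].
    by rewrite in_itv/= (le_trans m1 tT') andbT mulr_ge0// ltW.
  have st : `|t - m%:R * d| < d by rewrite ltr_norml; apply/andP; split; lra.
  have := hk (Some (m%:R * d, i)); rewrite c0E//.
  have -> : Some (m%:R * d, i) \in L.
    rewrite inE; apply/orP; right; apply: allpairs_f; last by rewrite mem_enum.
    by rewrite mem_iota/= add0n ltnS le_truncn// ler_pM2r ?invr_gt0.
  move=> /(_ isT).
  have := hd1 k t _ i tT sT (lt_le_trans st (_ : _ <= d1)).
  rewrite /d ge_min lexx => /(_ isT).
  have := hd2 t _ i tT sT (lt_le_trans st (_ : _ <= d2)).
  rewrite {1}/d ge_min lexx orbT => /(_ isT).
  rewrite /c0; move: (c k t i) (c k _ i) (q (Some (t, i))) (q _) => x1 x2 x3 x4.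
  rewrite !ler_norml !ltr_norml => /andP[? ?] /andP[? ?] /andP[? ?].
  by apply/andP; split; lra.
have [g Hg] := choice (fun z : nat * nat => key z.2.+1%:R^-1 z.1 (harmonic_gt0 z.2)).
(* The first argument of [g] is a lower bound for the index, here one past the previous index, for
   strict growth; the second sets the precision. *)
pose phi := fix phi n := if n is n'.+1 then g ((phi n').+1, n'.+1) else g (0%N, 0%N).
have Hphi n : `|A (phi n) - q None| <= n.+1%:R^-1 /\
    forall t i, t \in `[0, T] -> `|c (phi n) t i - c0 t i| <= n.+1%:R^-1.
  by case: n => [|n]; [have [_ ? ?] := Hg (0%N, 0%N)|
    have [_ ? ?] := Hg ((phi n).+1, n.+1)].
exists phi, c0, (q None); split=> [|n|n]; [|exact: (Hphi n).2|exact: (Hphi n).1].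
apply: homo_ltn => [? ? ?|n]; first exact: ltn_trans.
by have [] := Hg ((phi n).+1, n.+1).
Qed.

End Subsequence.

(** * Edge weights: uniform bound and continuity in the measure *)

Section Weights.
Context {R : realType} {d : nat} (Q : ('I_d -> R) -> 'I_d -> 'I_d -> R).
Hypothesis HQ : rate_family Q.
Local Notation edge := ('I_d * 'I_d)%type.
Implicit Types (mu nu : 'I_d -> R) (v : 'I_d -> 'I_d -> R) (p : edge).

(* Diagonal entries do not contribute to [ediv], and [wgt Q mu x x] need not
   depend continuously on [mu] (the diagonal of [Q] has no sign): both are
   replaced by zero. *)
Definition offdiag v p : R := if p.1 == p.2 then 0 else v p.1 p.2.

Definition edge_wgt mu : edge -> R := offdiag (wgt Q mu).

(** The weight is a separate argument because a convex combination of edge weights need not be the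
    edge weight of a measure. *)
Definition edge_action (u w : edge -> R) : \bar R :=
  ((2^-1)%:E * \sum_p alpha (u p) (w p))%E.

Lemma edge_action_ge0 u w : (0 <= edge_action u w)%E.
Proof. by rewrite mule_ge0// sume_ge0// => p _; exact: alpha_ge0. Qed.

Lemma prob_le1 mu x : is_prob mu -> mu x <= 1.
Proof.
by move=> [mu0 <-]; rewrite (bigD1 x)//= lerDl sumr_ge0.
Qed.

Lemma wgt_ge0 mu x y : 0 <= wgt Q mu x y.
Proof. exact: logmean_ge0. Qed.

Lemma edge_wgt_ge0 mu p : 0 <= edge_wgt mu p.
Proof. by rewrite /edge_wgt /offdiag; case: ifP => // _; exact: wgt_ge0. Qed.

Lemma edge_action_le mu v : (edge_action (offdiag v) (edge_wgt mu) <= action Q mu v)%E.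
Proof.
rewrite lee_wpmul2l// pair_bigA/=; apply: lee_sum => -[x y] _.
rewrite /edge_wgt /offdiag/=; case: ifP => _ //.
by rewrite /alpha ltxx eqxx/= alpha_ge0.
Qed.

(** Zero flux costs nothing at any nonnegative weight. The limit flux will have zero diagonal; for
    the given fluxes the preceding inequality points in the useful direction. *)
Lemma edge_actionE mu v : (forall x, v x x = 0) ->
  action Q mu v = edge_action (offdiag v) (edge_wgt mu).
Proof.
move=> v0; congr (_ * _)%E; rewrite pair_bigA/=; apply: eq_bigr => -[x y] _.
rewrite /edge_wgt /offdiag/=; case: eqP => // ->; rewrite v0 /alpha ltxx eqxx/=.
case: ltP => [_|w0]; first by rewrite expr0n/= mul0r.
by rewrite (_ : wgt _ _ _ _ == 0)// eq_le w0 wgt_ge0.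
Qed.

Lemma ediv_offdiag v x : ediv v x =
  2^-1 * \sum_y (offdiag v (x, y) - offdiag v (y, x)).
Proof.
congr (_ * _); apply: eq_bigr => y _; rewrite /offdiag/= (eq_sym y).
by case: eqP => // ->; rewrite subrr subr0.
Qed.

Lemma flux_lipschitz : exists2 K : R, 0 <= K & forall mu nu, is_prob mu -> is_prob nu ->
  forall x y, `|nu x * Q nu x y - mu x * Q mu x y| <=
    (K + `|Q mu x y|) * \sum_z `|nu z - mu z|.
Proof.
have [_ [_ [_ [L HL]]]] := HQ.
exists `|L| => // mu nu pmu pnu x y.
have -> : nu x * Q nu x y - mu x * Q mu x y =
  nu x * (Q nu x y - Q mu x y) + (nu x - mu x) * Q mu x y by ring.
have hs : `|nu x - mu x| <= \sum_z `|nu z - mu z|.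
  by rewrite (bigD1 x)//= lerDl sumr_ge0.
have s0 : 0 <= \sum_z `|nu z - mu z| by rewrite sumr_ge0.
rewrite (le_trans (ler_normD _ _))// [leRHS]mulrDl lerD// normrM.
  apply: (@le_trans _ _ (1 * (`|L| * \sum_z `|nu z - mu z|))); last by rewrite mul1r.
  apply: ler_pM => //.
    by rewrite ger0_norm ?(prob_le1 _ _ pnu)//; have [] := pnu.
  by rewrite (le_trans (HL _ _ pnu pmu x y))// ler_wpM2r// ler_norm.
by rewrite mulrC ler_wpM2l.
Qed.

Lemma flux_ge0 mu x y : is_prob mu -> x != y -> 0 <= mu x * Q mu x y.
Proof.
move=> pmu xy; have [Q0 _] := HQ; rewrite mulr_ge0 ?Q0//.
by have [] := pmu.
Qed.

Lemma edge_wgt_bounded mu : is_prob mu ->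
  exists2 M : R, 0 < M & forall nu p, is_prob nu -> edge_wgt nu p <= M.
Proof.
move=> pmu; have [K K0 HK] := flux_lipschitz.
pose S := \sum_x \sum_y `|Q mu x y|.
have QS x y : `|Q mu x y| <= S.
  rewrite /S (bigD1 x)//= (bigD1 y)//= -addrA lerDl addr_ge0 ?sumr_ge0// => z _.
  by rewrite sumr_ge0.
have S0 : 0 <= S by rewrite !sumr_ge0// => x _; rewrite sumr_ge0.
(* [S] bounds the fluxes at the reference measure [mu], 2 bounds the l1 distance of two probability
   vectors, and 1 makes [M] positive. *)
pose M := S + (K + S) * 2 + 1.
have M0 : 0 < M by rewrite ltr_wpDl// addr_ge0// mulr_ge0// addr_ge0.
exists M => // nu p pnu; rewrite /edge_wgt /offdiag.
case: eqP => [_|/eqP pp]; first exact: ltW.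
have fM x y : nu x * Q nu x y <= M.
  have h := HK _ _ pmu pnu x y.
  have s2 : \sum_z `|nu z - mu z| <= 2.
    have -> : (2 : R) = \sum_z (nu z + mu z).
      by rewrite big_split/= (proj2 pnu) (proj2 pmu).
    apply: ler_sum => z _; rewrite (le_trans (ler_normB _ _))//.
    by rewrite !ger0_norm//; [have [] := pmu|have [] := pnu].
  have {}h : `|nu x * Q nu x y - mu x * Q mu x y| <= (K + S) * 2.
    apply: (le_trans h); apply: ler_pM => //; rewrite ?addr_ge0// ?sumr_ge0//.
    by rewrite lerD2l QS.
  have : mu x * Q mu x y <= S.
    rewrite (le_trans (ler_norm _))// normrM -[S]mul1r ler_pM//.
    by rewrite ger0_norm ?(prob_le1 _ _ pmu)//; have [] := pmu.
  by move: h; rewrite ler_norml /M => /andP[_ ?] ?; lra.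
by apply: logmean_le; rewrite fM flux_ge0// eq_sym.
Qed.

Lemma edge_wgt_continuous mu p e : is_prob mu -> 0 < e ->
  exists2 r, 0 < r & forall nu, is_prob nu -> (forall z, `|nu z - mu z| < r) ->
    `|edge_wgt nu p - edge_wgt mu p| < e.
Proof.
move=> pmu e0; rewrite /edge_wgt /offdiag; case: eqP => [_|/eqP pp].
  by exists 1 => // nu _ _; rewrite subrr normr0.
move: p pp => [x y]/= xy; have yx : y != x by rewrite eq_sym.
have [r r0 hr] := logmean_continuous _ _ _ (flux_ge0 _ _ _ pmu xy)
  (flux_ge0 _ _ _ pmu yx) e0.
have [K K0 HK] := flux_lipschitz.
(* A common Lipschitz constant for both fluxes times the number of coordinates; the added ones keep
   it positive and the final estimate strict. *)
pose S := (K + (`|Q mu x y| + `|Q mu y x|) + 1) * (d%:R + 1).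
have d1 : 0 < d%:R + 1 :> R by rewrite ltr_wpDl.
have S1 : 0 < K + (`|Q mu x y| + `|Q mu y x|) + 1 by rewrite ltr_wpDl ?addr_ge0.
have S0 : 0 < S by rewrite mulr_gt0.
exists (r / S); first by rewrite divr_gt0.
move=> nu pnu nr.
have hs : \sum_z `|nu z - mu z| <= d%:R * (r / S).
  apply: (@le_trans _ _ (\sum_(z < d) r / S)); first by apply: ler_sum => z _; exact: ltW.
  by rewrite sumr_const card_ord mulr_natl.
have key k : 0 <= k -> k <= K + (`|Q mu x y| + `|Q mu y x|) ->
    k * \sum_z `|nu z - mu z| < r.
  move=> k0 kS; apply: (@le_lt_trans _ _ (k * (d%:R * (r / S)))).
    by rewrite ler_wpM2l.
  rewrite !mulrA ltr_pdivrMr// [ltLHS]mulrC ltr_pM2l// /S.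
  apply: (@le_lt_trans _ _ ((K + (`|Q mu x y| + `|Q mu y x|)) * d%:R)).
    by rewrite ler_wpM2r.
  rewrite ltr_pM//; rewrite ?addr_ge0// ?ltrDl//.
by apply: hr; rewrite ?flux_ge0//; apply: (le_lt_trans (HK _ _ pmu pnu _ _));
  apply: key; rewrite ?addr_ge0// lerD2l ?lerDl ?lerDr.
Qed.

End Weights.

(** For a nonnegative function the integral is a supremum over the simple functions below it, so it
    is monotone without measurability. This is what allows comparison with [action], whose diagonal
    weights need not vary continuously along a curve. *)
Lemma ge0_le_lower_integral (dd : measure_display) (X : measurableType dd) (R : realType)
    (mu : {measure set X -> \bar R}) (D : set X) (f g : X -> \bar R) :
  (forall t, D t -> (0 <= f t)%E) -> (forall t, D t -> (f t <= g t)%E) ->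
  (\int[mu]_(t in D) f t <= \int[mu]_(t in D) g t)%E.
Proof.
move=> f0 fg; have g0 t : D t -> (0 <= g t)%E by move=> Dt; rewrite (le_trans (f0 t Dt)) ?fg.
rewrite !ge0_integralE//; apply: le_ereal_sup => _ [h hf <-]; exists h => //= t.
by rewrite (le_trans (hf t))// /patch; case: ifPn => //; rewrite inE; exact: fg.
Qed.

(** * Integrals against test functions and the weak continuity equation *)

Section Pairing.
Context {R : realType} (T : R).
Local Notation mu := (@lebesgue_measure R).
Local Notation D := (`[0, T]%classic : set R).
Implicit Types (phi f g : R -> R).

Definition pairing phi f : R := Rintegral mu D (fun t => phi t * f t).

Lemma C1c_bounded phi : C1c T phi -> exists2 M : R, 0 <= M & forall t, D t -> `|phi t| <= M.
Proof.
move=> [dphi _].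
have cphi : continuous phi.
  by move=> x; apply/differentiable_continuous/derivable1_diffP/dphi.
have [T0|T0] := leP 0 T; last first.
  by exists 0 => // t; rewrite /= in_itv/= => /andP[t0 tT]; exfalso; lra.
have cn : {within `[0, T], continuous (fun t => `|phi t|)}.
  by apply: continuous_subspaceT => x; apply: cvg_norm; exact: cphi.
have [m _ hm] := EVT_max T0 cn.
by exists `|phi m| => // t Dt; exact: hm.
Qed.

Lemma C1c_measurable phi A : C1c T phi -> measurable_fun A phi.
Proof.
move=> [dphi _]; apply: measurable_funTS; apply: continuous_measurable_fun => x.
by apply/differentiable_continuous/derivable1_diffP/dphi.
Qed.

Lemma integrable_C1cM phi f : C1c T phi -> mu.-integrable D (EFin \o f) ->
  mu.-integrable D (EFin \o (fun t => phi t * f t)).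
Proof.
move=> Cphi fi; have [M M0 hM] := C1c_bounded phi Cphi.
have iM : mu.-integrable D (EFin \o (fun t => M * f t)) by have := integrableZl _ M fi; exact.
have /integrableP[/measurable_EFinP mf _] := fi.
apply: (le_integrable _ _ _ iM) => //.
  apply/measurable_EFinP; apply: measurable_funM; [exact: C1c_measurable|exact: mf].
move=> t Dt /=; rewrite lee_fin !normrM ler_wpM2r// (ger0_norm M0).
exact: hM.
Qed.

Lemma pairing_midpoint phi f g : C1c T phi -> mu.-integrable D (EFin \o f) ->
  mu.-integrable D (EFin \o g) ->
  pairing phi (fun t => 2^-1 * (f t + g t)) = 2^-1 * (pairing phi f + pairing phi g).
Proof.
move=> Cphi fi gi; have [fi' gi'] := (integrable_C1cM _ _ Cphi fi, integrable_C1cM _ _ Cphi gi).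
rewrite /pairing -RintegralD// -RintegralZl//.
  by apply: eq_Rintegral => t _; ring.
by have := integrableD _ fi' gi'; exact.
Qed.

Lemma pairing_cvg phi (f : nat -> R -> R) g : C1c T phi ->
  (forall n, mu.-integrable D (EFin \o f n)) -> mu.-integrable D (EFin \o g) ->
  (fun n => \int[mu]_(t in D) `|f n t - g t|%:E)%E @ \oo --> 0%E ->
  (fun n => pairing phi (f n)) @ \oo --> pairing phi g.
Proof.
move=> Cphi fi gi fg; have [M M0 hM] := C1c_bounded phi Cphi.
have fgi n : mu.-integrable D (EFin \o (fun t => f n t - g t)).
  by have := integrableB _ (fi n) gi; exact.
have fgi' n : mu.-integrable D (EFin \o (fun t => `|f n t - g t|)).
  exact: (integrable_norm (fgi n)).
have fgR : (fun n => Rintegral mu D (fun t => `|f n t - g t|)) @ \oo --> (0 : R).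
  exact: (fine_cvg fg).
apply/cvgrPdist_le => e e0.
have M1 : 0 < M + 1 by rewrite ltr_wpDl.
have e1 : 0 < e / (M + 1) by rewrite divr_gt0.
have [N _ hN] := (cvgrPdist_le _ _).1 fgR _ e1.
exists N => // n /hN; rewrite /= sub0r normrN => h.
rewrite distrC /pairing -RintegralB//; [|exact: integrable_C1cM..].
under eq_Rintegral do rewrite -mulrBr.
have ip := integrable_C1cM _ _ Cphi (fgi n).
apply: (le_trans (le_normr_Rintegral _ ip)) => //.
apply: (@le_trans _ _ (Rintegral mu D (fun t => M * `|f n t - g t|))).
  apply: le_Rintegral => //; first exact: (integrable_norm ip).
    by have := integrableZl _ M (fgi' n); exact.
  by move=> t Dt; rewrite normrM ler_wpM2r// hM.
rewrite RintegralZl//.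
have {}h : Rintegral mu D (fun t => `|f n t - g t|) <= e / (M + 1).
  exact: le_trans (ler_norm _) h.
apply: (@le_trans _ _ (M * (e / (M + 1)))); first by rewrite ler_wpM2l.
by rewrite mulrCA -[leRHS]mulr1 ler_wpM2l ?(ltW e0)// ler_pdivrMr// mul1r lerDl.
Qed.

Lemma pairing_sum (I : Type) (r : seq I) phi (F : I -> R -> R) : C1c T phi ->
  (forall i, mu.-integrable D (EFin \o F i)) ->
  pairing phi (fun t => \sum_(i <- r) F i t) = \sum_(i <- r) pairing phi (F i) /\
  mu.-integrable D (EFin \o (fun t => \sum_(i <- r) F i t)).
Proof.
move=> Cphi Fi; elim: r => [|i r [IH1 IH2]].
  rewrite /pairing big_nil; split.
    under eq_Rintegral do rewrite big_nil mulr0.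
    by rewrite Rintegral_cst// mul0r.
  by under [X in EFin \o X]eq_fun do rewrite big_nil; exact: integrable0.
split; last first.
  under [X in EFin \o X]eq_fun do rewrite big_cons.
  by have := integrableD _ (Fi i) IH2; exact.
rewrite big_cons -IH1 /pairing -RintegralD//; [|exact: integrable_C1cM..].
by apply: eq_Rintegral => t _; rewrite big_cons mulrDr.
Qed.

(** The weak continuity equation with its integral distributed over the edges: it is affine in [u],
    and L1 limits can be taken edge by edge. *)
Definition weak_form (d : nat) phi (c : R -> 'I_d -> R) (u : R -> 'I_d * 'I_d -> R) x : R :=
  pairing (derive1 phi) (c ^~ x) -
  2^-1 * \sum_y (pairing phi (u ^~ (x, y)) - pairing phi (u ^~ (y, x))).

Lemma weak_formE (d : nat) phi (c : R -> 'I_d -> R) (u : R -> 'I_d * 'I_d -> R) x :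
  C1c T phi -> {within D, continuous (c ^~ x)} ->
  (forall p, mu.-integrable D (EFin \o u ^~ p)) ->
  Rintegral mu D (fun t => derive1 phi t * c t x -
    phi t * (2^-1 * \sum_y (u t (x, y) - u t (y, x)))) = weak_form d phi c u x.
Proof.
move=> Cphi cc ui.
have iB y : mu.-integrable D (EFin \o (fun t => u t (x, y) - u t (y, x))).
  by have := integrableB _ (ui (x, y)) (ui (y, x)); exact.
have [hs hi] := pairing_sum _ (index_enum 'I_d) phi
  (fun y t => u t (x, y) - u t (y, x)) Cphi iB.
have iZ : mu.-integrable D (EFin \o (fun t => 2^-1 * \sum_y (u t (x, y) - u t (y, x)))).
  by have := integrableZl _ 2^-1 hi; exact.
rewrite RintegralB//; last exact: integrable_C1cM.
  congr (_ - _); under eq_Rintegral do rewrite mulrCA.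
  rewrite RintegralZl//; last exact: integrable_C1cM.
  congr (_ * _); apply: etrans hs _; apply: eq_bigr => y _.
  rewrite /pairing -RintegralB//; [|exact: integrable_C1cM..].
  by apply: eq_Rintegral => t _; rewrite mulrBr.
apply: within_continuous_integrable => t; apply: cvgM; last exact: cc.
have [_ [cphi _]] := Cphi; exact: (continuous_subspaceT cphi).
Qed.

End Pairing.

(** * Action bounds, L2 bounds and equicontinuity of curves *)

Section Curves.
Context {R : realType} {d : nat} (T : R).
Hypothesis T0 : 0 < T.
Local Notation edge := ('I_d * 'I_d)%type.
Local Notation mu := (@lebesgue_measure R).
Local Notation D := (`[0, T]%classic : set R).

Lemma measurable_edge_action (u w : R -> edge -> R) :
  (forall p, measurable_fun D (u ^~ p)) -> (forall p, measurable_fun D (w ^~ p)) ->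
  measurable_fun D (fun t => edge_action (u t) (w t)).
Proof.
move=> mu_ mw; apply: measurable_funeM; apply: emeasurable_sum => p.
exact: measurable_alpha.
Qed.

Lemma sqnorm_le_action (u w : R -> edge -> R) (M : R) : 0 < M ->
  (forall p, measurable_fun D (u ^~ p)) -> (forall p, measurable_fun D (w ^~ p)) ->
  (forall t p, D t -> 0 <= w t p <= M) ->
  (sqnorm mu D u <= (2 * M)%:E * \int[mu]_(t in D) edge_action (u t) (w t))%E.
Proof.
move=> M0 mu_ mw wM.
rewrite -ge0_integralZl_EFin//; first last.
- by rewrite mulr_ge0// ltW.
- exact: measurable_edge_action.
- by move=> t _; exact: edge_action_ge0.
apply: ge0_le_lower_integral => t Dt.
  by rewrite lee_fin sumr_ge0// => p _; exact: sqr_ge0.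
rewrite /edge_action muleA -EFinM mulrAC divff// mul1r -sumEFin ge0_sume_distrr.
  by apply: lee_sum => p _; apply: sqr_le_alpha => //; exact: wM.
by move=> p _; exact: alpha_ge0.
Qed.

Lemma CE_integrable_offdiag (m n : 'I_d -> R) c v p : CE T m n c v ->
  mu.-integrable D (EFin \o (fun t => offdiag (v t) p)).
Proof.
move=> [_ [_ [_ [_ [vi _]]]]]; rewrite /offdiag; case: eqP => _; last exact: vi.
exact: integrable0.
Qed.

Lemma CE_weak (m n : 'I_d -> R) c v : CE T m n c v -> forall phi, C1c T phi ->
  forall x, weak_form T d phi c (fun t => offdiag (v t)) x = 0.
Proof.
move=> H phi Cphi x; have [_ [cc [_ [_ [_ weak]]]]] := H.
rewrite -weak_formE//; last by move=> p; exact: CE_integrable_offdiag H.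
by rewrite -[RHS](weak _ Cphi x); apply: eq_Rintegral => t _; rewrite ediv_offdiag.
Qed.

Lemma CE_equicontinuous (B e : R) : 0 <= B -> 0 < e ->
  exists2 r, 0 < r & forall (m n : 'I_d -> R) c v, CE T m n c v ->
    (sqnorm mu D (fun t => offdiag (v t)) <= B%:E)%E ->
    forall s t x, s \in `[0, T] -> t \in `[0, T] -> `|s - t| < r ->
    `|c s x - c t x| <= e.
Proof.
move=> B0 e0.
pose N : R := #|{: edge}|%:R.
have N0 : 0 <= N by [].
(* Young's inequality on each of [N] edges gives [a (t - s) / 2 + B / (2a)]. This [a] makes the
   second terms sum to at most [e / 2], and the radius then does the same for the first; the added
   ones cover [N = 0] and [B = 0]. *)
pose a := (N + 1) * (B + 1) / e.
have a0 : 0 < a by rewrite divr_gt0// mulr_gt0// ltr_wpDl.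
exists (e / ((N + 1) * a)); first by rewrite divr_gt0// mulr_gt0// ltr_wpDl.
move=> m n c v H hB.
suff key s t x : 0 <= s -> s < t -> t <= T -> t - s < e / ((N + 1) * a) ->
    `|c t x - c s x| <= e.
  move=> s t x; rewrite !in_itv/= => /andP[s0 sT] /andP[t0 tT].
  case: (ltgtP s t) => [st|ts|->].
  - by rewrite distrC => hr; rewrite distrC key// (le_lt_trans (ler_norm _) hr).
  - by move=> hr; rewrite key// (le_lt_trans (ler_norm _) hr).
  - by move=> _; rewrite subrr normr0 ltW.
move=> s0 st tT hr; have [_ [cc [_ [_ [vi weak]]]]] := H.
have ip p := CE_integrable_offdiag _ _ _ _ p H.
have mp p : measurable_fun D (fun t => offdiag (v t) p).
  by have /integrableP[/measurable_EFinP] := ip p.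
pose g r := ediv (v r) x.
have gi : mu.-integrable D (EFin \o g).
  have -> : EFin \o g = (fun r => \sum_y (2^-1 * (offdiag (v r) (x, y) - offdiag (v r) (y, x)))%:E)%E.
    by apply/funext => r; rewrite /= sumEFin -mulr_sumr -ediv_offdiag.
  apply: integrable_sum => // y _.
  have := integrableZl _ 2^-1 (integrableB _ (ip (x, y)) (ip (y, x))); exact.
have inc := weak_derivative_increment _ _ _ _ _ T0 (cc x) gi (fun phi Cphi => weak phi Cphi x) s0 st tT.
apply: (le_trans inc).
have sub : `[s, t] `<=` `[0, T]%classic.
  by move=> r; rewrite /= !in_itv/= => /andP[r1 r2]; apply/andP; split; lra.
have gist : mu.-integrable `[s, t] (EFin \o g) by exact: integrableS gi.
rewrite -lee_fin /Rintegral fineK; last first.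
  by apply: integrable_fin_num => //; exact: (integrable_norm gist).
have mst p : measurable_fun `[s, t] (fun r => offdiag (v r) p) by exact: measurable_funS (mp p).
apply: (@le_trans _ _ (\int[mu]_(r in `[s, t]) \sum_(p : edge) `|offdiag (v r) p|%:E)%E).
  apply: ge0_le_lower_integral => r _; first by rewrite lee_fin.
  rewrite sumEFin lee_fin /g ediv_offdiag normrM ger0_norm// ler_pdivrMl//.
  apply: (le_trans (ler_norm_sum _ _ _)).
  apply: (@le_trans _ _ (\sum_y `|offdiag (v r) (x, y)| + \sum_y `|offdiag (v r) (y, x)|)).
    by rewrite -big_split/=; apply: ler_sum => y _; exact: ler_normB.
  have h1 : \sum_y `|offdiag (v r) (x, y)| <= \sum_p `|offdiag (v r) p|.
    rewrite -(pair_bigA _ (fun z y => `|offdiag (v r) (z, y)|))/= [leRHS](bigD1 x)//= lerDl.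
    by rewrite sumr_ge0// => z _; rewrite sumr_ge0.
  have h2 : \sum_y `|offdiag (v r) (y, x)| <= \sum_p `|offdiag (v r) p|.
    rewrite -(pair_bigA _ (fun z y => `|offdiag (v r) (z, y)|))/=.
    apply: ler_sum => z _; rewrite (bigD1 x)//= lerDl.
    by rewrite sumr_ge0.
  by rewrite mulr2n mulrDl !mul1r lerD.
rewrite ge0_integral_sum//; last first.
  move=> p; apply/measurable_EFinP; apply: measurableT_comp; last exact: mst.
  exact: normr_measurable.
have hm : mu `[s, t] = (t - s)%:E by rewrite lebesgue_measure_itv/= lte_fin st -EFinD.
have sB : (sqnorm mu `[s, t] (fun r => offdiag (v r)) <= B%:E)%E.
  apply: le_trans hB; apply: ge0_subset_integral => //.
    apply/measurable_EFinP; apply: measurable_sum => p.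
    by apply: measurable_funX; exact: mp.
  by move=> r _; rewrite lee_fin sumr_ge0// => p _; exact: sqr_ge0.
apply: (@le_trans _ _ (\sum_(p : edge) (2^-1 * a * (t - s) + 2^-1 / a * B)%:E)%E).
  apply: lee_sum => p _.
  have := @integral_abs_le_sqnorm _ _ _ mu `[s, t]%classic (measurable_itv _)
    _ (fun r => offdiag (v r)) a p a0 mst.
  move=> /le_trans; apply.
  rewrite [X in (_ * X + _ <= _)%E](_ : _ = (t - s)%:E); last exact: hm.
  rewrite -EFinM EFinD leeD2l// [leRHS]EFinM.
  by rewrite lee_wpmul2l// lee_fin mulr_ge0// invr_ge0 ltW.
rewrite sumEFin lee_fin sumr_const -mulr_natl -/N.
have h1 : N * (2^-1 * a * (t - s)) <= e / 2.
  have : (t - s) * ((N + 1) * a) <= e.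
    by rewrite -ler_pdivlMr ?ltW// mulr_gt0// ltr_wpDl.
  have : 0 <= a * (t - s) by rewrite mulr_ge0// ltW// subr_gt0.
  by nra.
have h2 : N * (2^-1 / a * B) <= e / 2.
  have -> : N * (2^-1 / a * B) = (N / (N + 1)) * (B / (B + 1)) * (e / 2).
    rewrite /a; field; rewrite !gt_eqF// ?ltr_wpDl//.
  have frac (y : R) : 0 <= y -> 0 <= y / (y + 1) <= 1.
    by move=> y0; rewrite divr_ge0 ?addr_ge0//= ler_pdivrMr ?ltr_wpDl// mul1r lerDl.
  have /andP[N1 N2] := frac N N0; have /andP[B1 B2] := frac B B0.
  by apply: ler_piMl; [rewrite divr_ge0// ltW|exact: mulr_ile1].
by rewrite mulrDr; lra.
Qed.

End Curves.

(** * The decreasing convex sets of relaxed fluxes *)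

Section Relaxed.
Context {R : realType} {d : nat} (T : R).
Local Notation edge := ('I_d * 'I_d)%type.
Local Notation mu := (@lebesgue_measure R).
Local Notation D := (`[0, T]%classic : set R).

Lemma edge_action_midpoint (u1 u2 w1 w2 : edge -> R) :
  (forall p, 0 <= w1 p) -> (forall p, 0 <= w2 p) ->
  (edge_action (fun p => (2^-1 * (u1 p + u2 p))%R) (fun p => (2^-1 * (w1 p + w2 p))%R) <=
   (2^-1)%:E * (edge_action u1 w1 + edge_action u2 w2))%E.
Proof.
move=> w10 w20; have s0 (u w : edge -> R) : (0 <= \sum_p alpha (u p) (w p))%E.
  by rewrite sume_ge0// => p _; exact: alpha_ge0.
rewrite /edge_action -[X in (_ <= _ * X)%E]ge0_muleDr//.
rewrite lee_wpmul2l// -big_split/= ge0_sume_distrr; last first.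
  by move=> p _; rewrite adde_ge0// alpha_ge0.
by apply: lee_sum => p _; exact: alpha_midpoint.
Qed.

(* The conditions below are stable under convex combinations and hold for all
   [v k] with [n <= k]; [w] stands for a combination of the weights [W k]. *)
Definition relaxed (c0 : R -> 'I_d -> R) (w0 : R -> edge -> R)
    (W : nat -> R -> edge -> R) (a M : R) (n : nat) : set (R -> edge -> R) :=
  [set u | [/\ forall p, mu.-integrable D (EFin \o u ^~ p),
    forall phi, C1c T phi -> forall x, `|weak_form T d phi c0 u x| <=
      n.+1%:R^-1 * Rintegral mu D (fun t => `|derive1 phi t|) &
    exists w : R -> edge -> R, [/\ forall p, measurable_fun D (w ^~ p),
      forall t p, D t -> 0 <= w t p <= M,
      forall t p e, D t -> (forall k, (n <= k)%N -> `|W k t p - w0 t p| <= e) ->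
        `|w t p - w0 t p| <= e &
      (\int[mu]_(t in D) edge_action (u t) (w t) <= (a + n.+1%:R^-1)%:E)%E]]].

Lemma relaxed_nonincreasing c0 w0 W a M n m : (n <= m)%N ->
  relaxed c0 w0 W a M m `<=` relaxed c0 w0 W a M n.
Proof.
move=> nm u [iu wu [w [mw wM ww uw]]].
have h : m.+1%:R^-1 <= n.+1%:R^-1 :> R by rewrite lef_pV2 ?posrE// ler_nat ltnS.
split=> //.
  move=> phi Cphi x; apply: (le_trans (wu phi Cphi x)); rewrite ler_wpM2r//.
  exact: Rintegral_ge0.
exists w; split=> //.
  by move=> t p e Dt H; apply: ww => // k mk; apply: H; exact: leq_trans mk.
by rewrite (le_trans uw)// lee_fin lerD2l.
Qed.

(** The witness is the midpoint of the two weights: the action is jointly convex in flux and weight,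
    [weak_form] is affine in the flux, and intervals centred at [w0 t p] are convex. *)
Lemma relaxed_midpoint c0 w0 W a M n u1 u2 :
  relaxed c0 w0 W a M n u1 -> relaxed c0 w0 W a M n u2 ->
  relaxed c0 w0 W a M n (midpoint u1 u2).
Proof.
move=> [i1 wu1 [w1 [mw1 wM1 ww1 uw1]]] [i2 wu2 [w2 [mw2 wM2 ww2 uw2]]].
have mid (x y k : R) : `|x| <= k -> `|y| <= k -> `|2^-1 * (x + y)| <= k.
  move=> xk yk; rewrite normrM ger0_norm// ler_pdivrMl// (le_trans (ler_normD _ _))//.
  by rewrite mulr2n mulrDl mul1r lerD.
split.
- move=> p.
  by have := integrableZl _ 2^-1 (integrableD _ (i1 p) (i2 p)); exact.
- move=> phi Cphi x; have -> : weak_form T d phi c0 (midpoint u1 u2) x =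
      2^-1 * (weak_form T d phi c0 u1 x + weak_form T d phi c0 u2 x).
    rewrite /weak_form.
    have -> : \sum_y (pairing T phi ((midpoint u1 u2)^~ (x, y)) -
        pairing T phi ((midpoint u1 u2)^~ (y, x))) =
      2^-1 * (\sum_y (pairing T phi (u1 ^~ (x, y)) - pairing T phi (u1 ^~ (y, x))) +
              \sum_y (pairing T phi (u2 ^~ (x, y)) - pairing T phi (u2 ^~ (y, x)))).
      rewrite -big_split/= mulr_sumr; apply: eq_bigr => y _.
      rewrite !pairing_midpoint//; ring.
    by field.
  by apply: mid; [exact: wu1|exact: wu2].
exists (midpoint w1 w2); split.
- move=> p; apply: measurable_funM => //; exact: measurable_funD.
- move=> t p Dt; have /andP[? ?] := wM1 t p Dt; have /andP[? ?] := wM2 t p Dt.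
  by rewrite /midpoint; apply/andP; split; lra.
- move=> t p e Dt H; have -> : midpoint w1 w2 t p - w0 t p =
      2^-1 * ((w1 t p - w0 t p) + (w2 t p - w0 t p)) by rewrite /midpoint; field.
  by apply: mid; [exact: ww1|exact: ww2].
have mu1 p : measurable_fun D (u1 ^~ p) by have /integrableP[/measurable_EFinP] := i1 p.
have mu2 p : measurable_fun D (u2 ^~ p) by have /integrableP[/measurable_EFinP] := i2 p.
have ma1 := measurable_edge_action T u1 w1 mu1 mw1.
have ma2 := measurable_edge_action T u2 w2 mu2 mw2.
apply: (@le_trans _ _ (\int[mu]_(t in D)
    ((2^-1)%:E * (edge_action (u1 t) (w1 t) + edge_action (u2 t) (w2 t))))%E).
  apply: ge0_le_lower_integral => t Dt; first exact: edge_action_ge0.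
  by apply: edge_action_midpoint => p; [have /andP[] := wM1 t p Dt|have /andP[] := wM2 t p Dt].
rewrite ge0_integralZl_EFin//; first last.
- exact: emeasurable_funD.
- by move=> t _; rewrite adde_ge0// edge_action_ge0.
rewrite ge0_integralD//; [|by move=> t _; exact: edge_action_ge0..].
have -> : (a + n.+1%:R^-1)%:E =
  ((2^-1)%:E * ((a + n.+1%:R^-1)%:E + (a + n.+1%:R^-1)%:E))%E :> \bar R.
  by rewrite -EFinD -EFinM; congr EFin; field.
by rewrite lee_wpmul2l// leeD.
Qed.

Lemma relaxed_sqnorm c0 w0 W a M n u : 0 < M -> relaxed c0 w0 W a M n u ->
  (sqnorm mu D u <= (2 * M * (a + 1))%:E)%E.
Proof.
move=> M0 [iu _ [w [mw wM _ uw]]].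
have mu_ p : measurable_fun D (u ^~ p) by have /integrableP[/measurable_EFinP] := iu p.
apply: (le_trans (sqnorm_le_action _ _ _ _ M0 mu_ mw wM)).
rewrite [leRHS]EFinM lee_wpmul2l//; first by rewrite lee_fin mulr_ge0// ltW.
apply: (le_trans uw); rewrite lee_fin lerD2l.
by rewrite invf_le1// ler1n.
Qed.

End Relaxed.

(** * Passing to the limit in curves, weights and action *)

Section Limit.
Context {R : realType} {d : nat} (T : R).
Local Notation edge := ('I_d * 'I_d)%type.
Local Notation mu := (@lebesgue_measure R).
Local Notation D := (`[0, T]%classic : set R).

Lemma uniform_limit_within_continuous (f : nat -> R -> R) (g : R -> R) :
  (forall n, {within D, continuous (f n)}) ->
  (forall n t, D t -> `|f n t - g t| <= n.+1%:R^-1) ->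
  {within D, continuous g}.
Proof.
move=> cf fg; apply/within_continuousP => x Dx e e0.
have e3 : 0 < e / 3 by rewrite divr_gt0.
have [N _ hN] := (cvgrPdist_lt _ _).1 (@cvg_harmonic R) _ e3.
have := hN N (leqnn N); rewrite /= sub0r normrN ger0_norm// => {}hN.
have [r r0 hr] := (within_continuousP _ _).1 (cf N) x Dx _ e3.
exists r => // y Dy yx; have h := hr y Dy yx.
have h1 := le_lt_trans (fg N x Dx) hN; have h2 := le_lt_trans (fg N y Dy) hN.
move: h h1 h2; rewrite !ltr_norml; clear => /andP[? ?] /andP[? ?] /andP[? ?].
by apply/andP; split; lra.
Qed.

Lemma prob_limit (m : nat -> 'I_d -> R) (m0 : 'I_d -> R) :
  (forall n, is_prob (m n)) -> (forall x, (m ^~ x) @ \oo --> m0 x) -> is_prob m0.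
Proof.
move=> mp mm; split.
  move=> x; rewrite -(cvg_lim _ (mm x))//; apply: limr_ge; first exact: (cvgP _ (mm x)).
  by apply: nearW => n; have [] := mp n.
have h : (fun n => \sum_x m n x) @ \oo --> \sum_x m0 x.
  by apply: cvg_big => [|x _]; [exact: add_continuous|exact: mm].
have h1 : (fun n => \sum_x m n x) @ \oo --> (1 : R).
  by under eq_fun do rewrite (mp _).2; exact: cvg_cst.
exact: cvg_unique h h1.
Qed.

Variables (Q : ('I_d -> R) -> 'I_d -> 'I_d -> R).
Hypothesis HQ : rate_family Q.

Lemma edge_wgt_curve_continuous (c0 : R -> 'I_d -> R) p : (forall t, D t -> is_prob (c0 t)) ->
  (forall x, {within D, continuous (c0 ^~ x)}) ->
  {within D, continuous (fun t => edge_wgt Q (c0 t) p)}.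
Proof.
move=> pc cc; apply/subspace_continuousP => t Dt.
apply/cvgrPdist_lt => e e0.
have [r r0 hr] := edge_wgt_continuous _ HQ (c0 t) p e (pc t Dt) e0.
have near_c : \forall s \near within D (nbhs t), forall z, `|c0 t z - c0 s z| < r.
  apply: filter_forall => z.
  by have /subspace_continuousP/(_ t Dt)/cvgrPdist_lt/(_ r r0) := cc z.
have near_D : \forall s \near within D (nbhs t), D s by exact: withinT.
apply: filterS2 near_c near_D => s sc Ds; rewrite distrC; apply: hr; first exact: pc.
by move=> z; rewrite distrC.
Qed.

Lemma edge_wgt_curve_cvg (c : nat -> R -> 'I_d -> R) (c0 : R -> 'I_d -> R) t p : (forall n, is_prob (c n t)) -> is_prob (c0 t) ->
  (forall x, (fun n => c n t x) @ \oo --> c0 t x) ->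
  (fun n => edge_wgt Q (c n t) p) @ \oo --> edge_wgt Q (c0 t) p.
Proof.
move=> pc pc0 cc; apply/cvgrPdist_lt => e e0.
have [r r0 hr] := edge_wgt_continuous _ HQ (c0 t) p e pc0 e0.
have near_c : \forall n \near \oo, forall z, `|c0 t z - c n t z| < r.
  by apply: filter_forall => z; exact: ((cvgrPdist_lt _ _).1 (cc z) r r0).
apply: filterS near_c => n sc; rewrite distrC; apply: hr => // z.
by rewrite distrC.
Qed.

Lemma edge_action_lsc (u_ w_ : nat -> R -> edge -> R) (u w : R -> edge -> R) (a : R) :
  (forall n p, measurable_fun D (u_ n ^~ p)) ->
  (forall n p, measurable_fun D (w_ n ^~ p)) ->
  (forall p, measurable_fun D (u ^~ p)) -> (forall p, measurable_fun D (w ^~ p)) ->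
  (forall n t p, D t -> 0 <= w_ n t p) -> (forall t p, D t -> 0 <= w t p) ->
  (forall p, {ae mu, forall t, D t -> (fun n => u_ n t p) @ \oo --> u t p}) ->
  (forall t p, D t -> (fun n => w_ n t p) @ \oo --> w t p) ->
  (forall n, (\int[mu]_(t in D) edge_action (u_ n t) (w_ n t) <= (a + n.+1%:R^-1)%:E)%E) ->
  (\int[mu]_(t in D) edge_action (u t) (w t) <= a%:E)%E.
Proof.
move=> mu_ mw_ mu0 mw0 w_0 w0 ucv wcv bnd.
(* The factor 1/2 is moved out of the integral, so that Fatou and the superadditivity of lower
   limits act on a plain sum. *)
pose S (x y : edge -> R) : \bar R := (\sum_p alpha (x p) (y p))%E.
have S0 x y : (0 <= S x y)%E by rewrite sume_ge0// => p _; exact: alpha_ge0.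
have mS (x y : R -> edge -> R) : (forall p, measurable_fun D (x ^~ p)) ->
    (forall p, measurable_fun D (y ^~ p)) -> measurable_fun D (fun t => S (x t) (y t)).
  by move=> mx my; apply: emeasurable_sum => p; exact: measurable_alpha.
have IS (x y : R -> edge -> R) : (forall p, measurable_fun D (x ^~ p)) ->
    (forall p, measurable_fun D (y ^~ p)) ->
    (\int[mu]_(t in D) edge_action (x t) (y t) =
     (2^-1)%:E * \int[mu]_(t in D) S (x t) (y t))%E.
  by move=> mx my; rewrite -ge0_integralZl_EFin//; exact: mS.
have bS n : (\int[mu]_(t in D) S (u_ n t) (w_ n t) <= (2 * (a + n.+1%:R^-1))%:E)%E.
  have := bnd n; rewrite IS// => h.
  by rewrite EFinM -lee_pdivrMl.
have fat := @fatou _ _ R mu D _ (fun n t => S (u_ n t) (w_ n t))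
  (fun n => mS _ _ (mu_ n) (mw_ n)) (fun n t _ => S0 _ _).
have lim2a : (fun n => (2 * (a + n.+1%:R^-1))%:E) @ \oo --> (2 * a)%:E.
  apply: cvg_EFin; first exact: nearW.
  apply: cvgMr; rewrite -[X in _ --> X]addr0.
  by apply: cvgD; [exact: cvg_cst|exact: (@cvg_harmonic R)].
rewrite IS// lee_pdivrMl// -EFinM.
rewrite -(cvg_limn_einf_sup lim2a).1.
apply: le_trans (le_limn_einf _ _ bS).
apply: le_trans (fat _) => //.
apply: ae_ge0_le_integral => //.
- exact: mS.
- by move=> t Dt; exact: limn_einf_ge0.
- have -> : (fun t => limn_einf (fun n => S (u_ n t) (w_ n t))) =
    (fun t => - limn_esup (fun n => - S (u_ n t) (w_ n t)))%E.
    by apply/funext => t; rewrite -limn_einfN; congr limn_einf; apply/funext => n /=; rewrite oppeK.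
  apply: measurableT_comp => //; apply: measurable_fun_limn_esup => n.
  by apply: measurableT_comp => //; exact: mS.
have ucv' : {ae mu, forall t, forall p, D t -> (fun n => u_ n t p) @ \oo --> u t p}.
  exact: filter_forall.
have FF : Filter (almost_everywhere mu) by exact: ae_filter_ringOfSetsType.
apply: (@filterS _ _ FF _ _ _ ucv') => t ut Dt.
apply: le_trans (limn_einf_sum_ge _ _ _ _); last by move=> p n; exact: alpha_ge0.
apply: lee_sum => p _; apply: alpha_lsc.
- by move=> n; exact: w_0.
- exact: w0.
- exact: ut.
- exact: wcv.
Qed.

End Limit.

(** * Relaxed fluxes along the subsequence, and the final assembly *)

Section Main.
Context {R : realType} {d : nat} (Q : ('I_d -> R) -> 'I_d -> 'I_d -> R).
Hypothesis HQ : rate_family Q.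
Variable T : R.
Local Notation edge := ('I_d * 'I_d)%type.
Local Notation mu := (@lebesgue_measure R).
Local Notation D := (`[0, T]%classic : set R).

Lemma edge_wgt_curve_measurable (c : R -> 'I_d -> R) p : (forall t, D t -> is_prob (c t)) ->
  (forall x, {within D, continuous (c ^~ x)}) ->
  measurable_fun D (fun t => edge_wgt Q (c t) p).
Proof.
move=> pc cc; apply: subspace_continuous_measurable_fun => //.
exact: edge_wgt_curve_continuous.
Qed.

(** The pair [(c, v)] solves its own equation exactly, so the error for [c0] is the pairing of
    [phi'] with [c0 - c], at most the uniform distance times the L1 norm of [phi']. *)
Lemma relaxed_curve (c c0 : R -> 'I_d -> R) (v : R -> 'I_d -> 'I_d -> R)
    (W : nat -> R -> edge -> R) (a M : R) (n : nat) (m m' : 'I_d -> R) :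
  CE T m m' c v ->
  (forall x, {within D, continuous (c0 ^~ x)}) ->
  (forall t x, D t -> `|c t x - c0 t x| <= n.+1%:R^-1) ->
  W n = (fun t => edge_wgt Q (c t)) ->
  (forall nu p, is_prob nu -> edge_wgt Q nu p <= M) ->
  (\int[mu]_(t in D) edge_action (offdiag (v t)) (edge_wgt Q (c t)) <=
     (a + n.+1%:R^-1)%:E)%E ->
  relaxed T c0 (fun t => edge_wgt Q (c0 t)) W a M n (fun t => offdiag (v t)).
Proof.
move=> H cc0 cn Wn wM act; have [pc [cc _]] := H.
have pcD t : D t -> is_prob (c t) by move=> Dt; apply: pc.
split.
- by move=> p; exact: CE_integrable_offdiag H.
- move=> phi Cphi x.
  have cphi' : {within D, continuous (derive1 phi)}.
    by have [_ [h _]] := Cphi; exact: continuous_subspaceT.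
  have wP (f : R -> R) : {within D, continuous f} ->
      mu.-integrable D (EFin \o (fun t => derive1 phi t * f t)).
    move=> cf; apply: within_continuous_integrable => t.
    by apply: cvgM; [exact: cphi'|exact: cf].
  have wB : {within D, continuous (fun t => c0 t x - c t x)}.
    by move=> t; apply: cvgB; [exact: cc0|exact: cc].
  have -> : weak_form T d phi c0 (fun t => offdiag (v t)) x =
      pairing T (derive1 phi) (fun t => c0 t x - c t x).
    rewrite -[LHS]subr0 -(CE_weak _ _ _ _ _ H _ Cphi x) /weak_form opprB addrA subrK.
    rewrite /pairing -RintegralB//; [|exact: wP (cc0 x)|exact: wP (cc x)].
    by apply: eq_Rintegral => t _; rewrite mulrBr.
  apply: (le_trans (le_normr_Rintegral _ (wP _ wB))) => //.
  have iphi : mu.-integrable D (EFin \o (fun t => `|derive1 phi t|)).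
    exact: (integrable_norm (within_continuous_integrable _ _ _ cphi')).
  rewrite -RintegralZl//; apply: le_Rintegral => //.
    exact: (integrable_norm (wP _ wB)).
    by have := integrableZl _ n.+1%:R^-1 iphi; exact.
  by move=> t Dt; rewrite normrM mulrC ler_wpM2r// distrC cn.
exists (fun t => edge_wgt Q (c t)); split => //.
- by move=> p; exact: edge_wgt_curve_measurable.
- by move=> t p Dt; rewrite edge_wgt_ge0 wM//; exact: pcD.
- by move=> t p e Dt /(_ n (leqnn n)); rewrite Wn.
Qed.

Lemma relaxed_limit (c0 : R -> 'I_d -> R) (W : nat -> R -> edge -> R) (a M : R)
    (u : nat -> R -> edge -> R) (v0 : R -> edge -> R) :
  (forall t, D t -> is_prob (c0 t)) ->
  (forall x, {within D, continuous (c0 ^~ x)}) ->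
  (forall t p, D t -> (fun n => W n t p) @ \oo --> edge_wgt Q (c0 t) p) ->
  (forall n, relaxed T c0 (fun t => edge_wgt Q (c0 t)) W a M n (u n)) ->
  (forall p, [/\ mu.-integrable D (EFin \o v0 ^~ p),
      {ae mu, forall t, D t -> (fun n => u n t p) @ \oo --> v0 t p} &
      ((fun n => \int[mu]_(t in D) `|u n t p - v0 t p|%:E) @ \oo --> 0)%E]) ->
  (forall phi, C1c T phi -> forall x, weak_form T d phi c0 v0 x = 0) /\
  (\int[mu]_(t in D) edge_action (v0 t) (edge_wgt Q (c0 t)) <= a%:E)%E.
Proof.
move=> pc0 cc0 Wcv Ku uv; split.
  move=> phi Cphi x.
  have P p : (fun n => pairing T phi (u n ^~ p)) @ \oo --> pairing T phi (v0 ^~ p).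
    have [iv _ uv0] := uv p; apply: pairing_cvg => // n.
    by have [iu _ _] := Ku n; exact: iu.
  have L : (fun n => weak_form T d phi c0 (u n) x) @ \oo --> weak_form T d phi c0 v0 x.
    apply: cvgB; first exact: cvg_cst.
    apply: cvgMr; apply: cvg_big => [|y _]; first exact: add_continuous.
    by apply: cvgB; exact: P.
  suff L0 : (fun n => weak_form T d phi c0 (u n) x) @ \oo --> (0 : R).
    exact: cvg_unique L L0.
  pose K := Rintegral mu D (fun t => `|derive1 phi t|).
  have K0 : (fun n => n.+1%:R^-1 * K) @ \oo --> (0 : R).
    by rewrite -(mul0r K); apply: cvgMl; exact: (@cvg_harmonic R).
  apply: (@squeeze_cvgr _ _ _ _ (fun n => - (n.+1%:R^-1 * K)) (fun n => n.+1%:R^-1 * K)) => //.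
    by apply: nearW => n; rewrite -ler_norml; have [_ wu _] := Ku n; exact: wu.
  by rewrite -oppr0; exact: cvgN.
have Hw n : exists w : R -> edge -> R, [/\ forall p, measurable_fun D (w ^~ p),
      forall t p, D t -> 0 <= w t p <= M,
      forall t p e, D t -> (forall k, (n <= k)%N -> `|W k t p - edge_wgt Q (c0 t) p| <= e) ->
        `|w t p - edge_wgt Q (c0 t) p| <= e &
      (\int[mu]_(t in D) edge_action (u n t) (w t) <= (a + n.+1%:R^-1)%:E)%E].
  by have [_ _] := Ku n.
have [w Hw'] := choice Hw.
apply: (@edge_action_lsc _ _ T u w) => //.
- move=> n p; have [iu _ _] := Ku n.
  by have /integrableP[/measurable_EFinP] := iu p.
- by move=> n p; have [] := Hw' n.
- by move=> p; have [/integrableP[/measurable_EFinP]] := uv p.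
- by move=> p; exact: edge_wgt_curve_measurable.
- by move=> n t p Dt; have [_ wM _ _] := Hw' n; have /andP[] := wM t p Dt.
- by move=> t p Dt; exact: edge_wgt_ge0.
- by move=> p; have [] := uv p.
(* Once all [W k] with [k >= N] are within [e] of the limit weight at [(t, p)], so is every witness
   [w n] with [n >= N]; [N] may depend on [t] and [p]. *)
- move=> t p Dt; apply/cvgrPdist_le => e e0.
  have [N _ hN] := (cvgrPdist_le _ _).1 (Wcv t p Dt) _ e0.
  exists N => // n Nn; rewrite distrC; have [_ _ ww _] := Hw' n.
  apply: ww => // k nk; rewrite distrC; apply: hN.
  exact: leq_trans nk.
- by move=> n; have [] := Hw' n.
Qed.

End Main.

Theorem theorem4p5 (R : realType) (d : nat)
  (Q : ('I_d -> R) -> 'I_d -> 'I_d -> R) (HQ : rate_family Q)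
  (T : R) (hT : 0 < T)
  (c : nat -> R -> 'I_d -> R) (v : nat -> R -> 'I_d -> 'I_d -> R)
  (hCE : forall k, CE T (c k 0) (c k T) (c k) (v k))
  (C : R) (hC : forall k, (total_action Q T (c k) (v k) <= C%:E)%E) :
  exists (phi : nat -> nat) (c0 : R -> 'I_d -> R) (v0 : R -> 'I_d -> 'I_d -> R),
    (forall n m, (n < m)%N -> (phi n < phi m)%N) /\
    (forall eps : R, 0 < eps -> exists N : nat, forall k, (N <= k)%N ->
       forall t, t \in `[0, T] -> forall x, `|c (phi k) t x - c0 t x| < eps) /\
    CE T (c0 0) (c0 T) c0 v0 /\
    (limn_einf (fun k => total_action Q T (c (phi k)) (v (phi k)))
       >= total_action Q T c0 v0)%E.
Proof.
pose mu := @lebesgue_measure R.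
pose D := (`[0, T]%classic : set R).
have pc k t : D t -> is_prob (c k t) by move=> Dt; have [h _] := hCE k; exact: h.
have cc k x : {within `[0, T], continuous (c k ^~ x)} by have [_ [h _]] := hCE k; exact: h.
have D0 : D 0 by rewrite /D/= in_itv/= lexx ltW.
have [M M0 wM] := edge_wgt_bounded _ HQ _ (pc 0%N 0 D0).
have total_ge0 c' v' : (0 <= total_action Q T c' v')%E.
  apply: integral_ge0 => t _; rewrite mule_ge0// sume_ge0// => x _.
  by rewrite sume_ge0// => y _; exact: alpha_ge0.
(* The actions form a bounded real sequence, so they can converge along the same subsequence as the
   curves; their limit [a] is then the lower limit in the conclusion. *)
pose A k := fine (total_action Q T (c k) (v k)).
have AE k : total_action Q T (c k) (v k) = (A k)%:E.
  by rewrite fineK// ge0_fin_numE// (le_lt_trans (hC k))// ltry.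
have AC k : 0 <= A k <= C by rewrite -!lee_fin -AE total_ge0 hC.
have C0 : 0 <= C by have /andP[] := AC 0%N; exact: le_trans.
have act k : (\int[mu]_(t in D) edge_action (offdiag (v k t)) (edge_wgt Q (c k t)) <=
    (A k)%:E)%E.
  rewrite -AE; apply: ge0_le_lower_integral => t Dt; first exact: edge_action_ge0.
  exact: edge_action_le.
have mV k p : measurable_fun D (fun t => offdiag (v k t) p).
  by have /integrableP[/measurable_EFinP] := CE_integrable_offdiag T _ _ _ _ p (hCE k).
have V2 k : (sqnorm mu D (fun t => offdiag (v k t)) <= (2 * M * C)%:E)%E.
  have mW p : measurable_fun D (fun t => edge_wgt Q (c k t) p).
    by apply: edge_wgt_curve_measurable => //; exact: pc.
  have wb t p : D t -> 0 <= edge_wgt Q (c k t) p <= M.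
    by move=> Dt; rewrite edge_wgt_ge0 wM//; exact: pc.
  apply: (le_trans (sqnorm_le_action T _ _ _ M0 (mV k) mW wb)).
  rewrite [leRHS]EFinM lee_wpmul2l//; first by rewrite lee_fin mulr_ge0// ltW.
  by rewrite (le_trans (act k))// -AE hC.
have [phi [c0 [a [phi_mono hc0 ha]]]] : exists (phi : nat -> nat) (c0 : R -> 'I_d -> R) (a : R),
    [/\ {homo phi : n m / (n < m)%N},
        forall n t i, t \in `[0, T] -> `|c (phi n) t i - c0 t i| <= n.+1%:R^-1 &
        forall n, `|A (phi n) - a| <= n.+1%:R^-1].
  apply: (@equicontinuous_subsequence _ _ T C) => //.
    move=> k t i tT; have pkt := pc k t tT.
    by rewrite (prob_le1 _ _ pkt) andbT; have [] := pkt.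
  move=> e e0; have B0 : 0 <= 2 * M * C by rewrite !mulr_ge0// ltW.
  have [r r0 hr] := @CE_equicontinuous R d T hT _ _ B0 e0.
  exists r => // k s t i sT tT st.
  exact: (hr _ _ _ _ (hCE k) (V2 k)).
have cv0 t x : D t -> (fun n => c (phi n) t x) @ \oo --> c0 t x.
  by move=> Dt; apply: harmonic_bound_cvg => n; exact: hc0.
have pc0 t : D t -> is_prob (c0 t).
  move=> Dt; apply: (@prob_limit _ _ (fun n => c (phi n) t)) => [n|x]; first exact: pc.
  exact: cv0.
have cc0 x : {within `[0, T], continuous (c0 ^~ x)}.
  apply: (@uniform_limit_within_continuous _ T (fun n t => c (phi n) t x)) => [n|n t Dt].
    exact: cc.
  exact: hc0.
pose W n t := edge_wgt Q (c (phi n) t).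
pose w0 t := edge_wgt Q (c0 t).
have Wcv t p : D t -> (fun n => W n t p) @ \oo --> w0 t p.
  move=> Dt; apply: (@edge_wgt_curve_cvg _ _ Q HQ (fun n => c (phi n))) => [n||x].
  - exact: pc.
  - exact: pc0.
  - exact: cv0.
pose K := relaxed T c0 w0 W a M.
have KV n : K n (fun t => offdiag (v (phi n) t)).
  apply: (relaxed_curve Q HQ T (c (phi n)) c0 (v (phi n)) W a M n _ _ (hCE (phi n))) => //.
    by move=> t x Dt; exact: hc0.
  apply: (le_trans (act _)); rewrite lee_fin -lerBlDl.
  exact: le_trans (ler_norm _) (ha n).
have [u [v0 [Ku uv]]] : exists (u : nat -> R -> 'I_d * 'I_d -> R) (v0 : R -> 'I_d * 'I_d -> R),
    (forall n, K n (u n)) /\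
    forall p, [/\ mu.-integrable D (EFin \o v0 ^~ p),
      {ae mu, forall t, D t -> (fun n => u n t p) @ \oo --> v0 t p} &
      ((fun n => \int[mu]_(t in D) `|u n t p - v0 t p|%:E) @ \oo --> 0)%E].
  apply: (@mazur_ae _ _ _ mu D (measurable_itv _) (lebesgue_itv_lty 0 T) _ K
    (2 * M * (a + 1))).
  - by move=> n; exists (fun t => offdiag (v (phi n) t)).
  - by move=> n m nm; exact: relaxed_nonincreasing.
  - by move=> n u w; exact: relaxed_midpoint.
  - by move=> n u [iu _ _] p; have /integrableP[/measurable_EFinP] := iu p.
  - by move=> n u; exact: relaxed_sqnorm.
have [weak0 act0] := relaxed_limit _ HQ _ _ _ _ _ _ _ pc0 cc0 Wcv Ku uv.
(* Clearing the diagonal leaves the divergence unchanged and cannot raise the edge action, and it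
   makes [edge_actionE] applicable. *)
exists phi, c0, (fun t x y => if x == y then 0 else v0 t (x, y)).
split=> //; split; [|split].
- move=> e e0; have [N _ hN] := (cvgrPdist_lt _ _).1 (@cvg_harmonic R) _ e0.
  exists N => k /hN; rewrite /= sub0r normrN ger0_norm// => ke t tT x.
  by apply: le_lt_trans ke; exact: hc0.
- split=> //; split=> //; split=> //; split=> //; split.
    move=> x y; case: eqP => _; first exact: integrable0.
    by have [iv _ _] := uv (x, y).
  move=> psi Cpsi x; rewrite -[RHS](weak0 psi Cpsi x) -weak_formE//; last first.
    by move=> p; have [iv _ _] := uv p.
  apply: eq_Rintegral => t _; congr (_ - _ * (_ * _)); apply: eq_bigr => y _.
  by rewrite (eq_sym y); case: eqP => // ->; rewrite !subrr.
have -> : limn_einf (fun k => total_action Q T (c (phi k)) (v (phi k))) = a%:E.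
  under eq_fun do rewrite AE.
  have Aa : (fun n => (A (phi n))%:E) @ \oo --> a%:E.
    by apply: cvg_EFin; [exact: nearW|exact: harmonic_bound_cvg].
  exact: (cvg_limn_einf_sup Aa).1.
apply: le_trans act0; apply: ge0_le_lower_integral => t Dt.
  rewrite mule_ge0// sume_ge0// => x _.
  by rewrite sume_ge0// => y _; exact: alpha_ge0.
rewrite edge_actionE => [|x]; last by rewrite eqxx.
rewrite lee_wpmul2l//; apply: lee_sum => -[x y] _.
rewrite /edge_wgt /offdiag/=; case: eqP => _ //.
by rewrite {1}/alpha ltxx eqxx/= alpha_ge0.
Qed.
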